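(* Let $\Delta\ge 0$, let $n,m\ge 1$ be integers, and let $f:\mathcal X^n\times\mathbb R^m\to\mathbb R^n$ be Lipschitz on bounded sets with $f(0,0)=0$. Assume that there exist a functional $V:\mathcal X^n\to\mathbb R_{\ge 0}$ which is Lipschitz on bounded sets, constants $a,c,\bar c\ge 0$, functions $\alpha,\overline\alpha\in\mathcal K_\infty$, and $\gamma\in\mathcal N$ such that, for all $\phi\in\mathcal X^n$ and all $v\in\mathbb R^m$, $$\alpha(|\phi(0)|)\le V(\phi)\le \overline\alpha(\|\phi\|)+\bar c,$$ $$D^+V(\phi,f(\phi,v))\le a\,\alpha(\|\phi\|)+\gamma(|v|)+c.$$ Then the system $\dot x(t)=f(x_t,u(t))$ is robustly forward complete.
   Context: $\mathcal X^n$ is the set of continuous functions $\phi:[-\Delta,0]\to\mathbb R^n$, with $\|\phi\|=\max_{\tau\in[-\Delta,0]}|\phi(\tau)|$, where $|\cdot|$ is the Euclidean norm. A map is Lipschitz on bounded sets if its restriction to every bounded set is Lipschitz. $\mathcal U^m$ is the set of Lebesgue measurable, locally essentially bounded signals $u:\mathbb R_{\ge 0}\to\mathbb R^m$; $\|u\|$ is the essential supremum of $|u|$ on $\mathbb R_{\geq 0}$. For a continuous $x:[-\Delta,T)\to\mathbb R^n$ and $t\in[0,T)$, $x_t\in\mathcal X^n$ is $x_t(\tau):=x(t+\tau)$, $\tau\in[-\Delta,0]$. For an initial state $x_0\in\mathcal X^n$ and $u\in\mathcal U^m$, the solution of $\dot x(t)=f(x_t,u(t))$ is the (unique, maximal)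 locally absolutely continuous solution, the equation holding for almost every $t\geq 0$ in the existence interval. Class $\mathcal N$: functions $\mathbb R_{\ge 0}\to\mathbb R_{\ge 0}$ that are continuous, non-decreasing and zero at zero. Class $\mathcal K_\infty$: functions $\mathbb R_{\ge 0}\to\mathbb R_{\ge 0}$ that are continuous, (strictly) increasing, zero at zero and tend to $+\infty$ at $+\infty$. Driver derivative: for $V:\mathcal X^n\to\mathbb R_{\ge 0}$, $\phi\in\mathcal X^n$, $w\in\mathbb R^n$, $D^+V(\phi,w):=\limsup_{h\to 0^+}\frac{V(\phi_{h,w})-V(\phi)}{h}$, where for $h\in[0,\Delta)$, $\phi_{h,w}(s):=\phi(s+h)$ if $s\in[-\Delta,-h)$ and $\phi_{h,w}(s):=\phi(0)+(h+s)w$ if $s\in[-h,0]$. (If $\Delta=0$, $\mathcal X^n$ is identified with $\mathbb R^n$ and $\phi_{h,w}:=\phi(0)+hw$ for $h\geq 0$.) Robust forward completeness: for all $T,r>0$ there exists $R>0$ such that, for all $x_0\in\mathcal X^n$ and all $u\in\mathcal U^m$ with $\|x_0\|\le r$ and $\|u\|\le r$, the corresponding solution of $\dot x(t)=f(x_t,u(t))$ exists on $[0,T]$ and satisfies $\sup_{t\in[0,T]}|x(t)|\le R$. *)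

(* Defs.v *)
From mathcomp Require Export all_boot all_order all_algebra.
From mathcomp Require Export all_classical all_reals all_analysis.
From mathcomp Require Export measurable_realfun ess_sup_inf.

Set Implicit Arguments.
Unset Strict Implicit.
Unset Printing Implicit Defensive.

Import Order.TTheory GRing.Theory Num.Theory.
Export numFieldNormedType.Exports.

Local Open Scope classical_set_scope.
Local Open Scope ring_scope.

(* The library norm on ['rV[R]_n] is the max norm. *)
Definition enorm (R : realType) (n : nat) (x : 'rV[R]_n) : R :=
  Num.sqrt (\sum_(i < n) x ord0 i ^+ 2).

(* An element of X^n is represented by a total function that is continuous on
   [-Delta, 0]; its values outside [-Delta, 0] are irrelevant. A functional on
   X^n is a function on [R -> 'rV[R]_n], only ever evaluated on this set. Being
   Lipschitz on bounded sets for [hist_norm], which only sees [-Delta, 0], forces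
   it to depend on the restriction to [-Delta, 0] alone. *)
Definition hist (R : realType) (Delta : R) (n : nat) : set (R -> 'rV[R]_n) :=
  [set phi | {within `[- Delta, 0], continuous phi}].

Definition hist_norm (R : realType) (Delta : R) (n : nat)
    (phi : R -> 'rV[R]_n) : R :=
  sup [set enorm (phi tau) | tau in `[- Delta, 0]].

Definition lipschitz_on_bounded_sets (R : realType) (E F : zmodType)
    (NE : E -> R) (NF : F -> R) (D : set E) (g : E -> F) : Prop :=
  forall B : set E, B `<=` D -> (exists r : R, forall p, B p -> NE p <= r) ->
  exists L : R, forall p q, B p -> B q -> NF (g p - g q) <= L * NE (p - q).

Definition vector_field_lipschitz (R : realType) (Delta : R) (n m : nat)
    (f : (R -> 'rV[R]_n) -> 'rV[R]_m -> 'rV[R]_n) : Prop :=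
  lipschitz_on_bounded_sets
    (fun p : (R -> 'rV[R]_n) * 'rV[R]_m => hist_norm Delta p.1 + enorm p.2)
    (@enorm R n)
    (hist Delta (n:=n) `*` setT) (fun p => f p.1 p.2).

Definition functional_lipschitz (R : realType) (Delta : R) (n : nat)
    (V : (R -> 'rV[R]_n) -> R) : Prop :=
  lipschitz_on_bounded_sets (@hist_norm R Delta n) (fun y : R => `|y|)
    (hist Delta (n:=n)) V.

(* Functions on the nonnegative reals are total functions considered on
   [0, +oo[ only; nonnegativity of their values follows from monotonicity. *)
Definition class_N (R : realType) (g : R -> R) : Prop :=
  [/\ {within `[0, +oo[, continuous g},
      (forall s t : R, 0 <= s -> s <= t -> g s <= g t) &
      g 0 = 0].

Definition class_Kinfty (R : realType) (g : R -> R) : Prop :=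
  [/\ {within `[0, +oo[, continuous g},
      (forall s t : R, 0 <= s -> s < t -> g s < g t),
      g 0 = 0 &
      g t @[t --> +oo] --> +oo].

(* For 0 <= h < Delta these are the two branches on [-Delta, -h) and [-h, 0].
   For Delta = 0 and h >= 0 the value at the only point 0 is phi 0 + h *: w. *)
Definition driver_shift (R : realType) (n : nat) (phi : R -> 'rV[R]_n) (h : R)
    (w : 'rV[R]_n) : R -> 'rV[R]_n :=
  fun s => if s < - h then phi (s + h) else phi 0 + (h + s) *: w.

Definition driver_derivative (R : realType) (n : nat)
    (V : (R -> 'rV[R]_n) -> R) (phi : R -> 'rV[R]_n) (w : 'rV[R]_n) : \bar R :=
  limf_esup (fun h : R => ((V (driver_shift phi h w) - V phi) / h)%:E) 0^'+.

Definition lebesgue_measurable_signal (R : realType) (m : nat)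
    (u : R -> 'rV[R]_m) : Prop :=
  forall O : set 'rV[R]_m, open O ->
    (completed_algebra_gen (@lebesgue_measure R)).-sigma.-measurable
      (`[0, +oo[ `&` u @^-1` O).

(* The patch [\_] is 0 off the set, hence does not affect the essential
   supremum of a nonnegative function over a set of positive measure. *)
Definition ess_sup_on (R : realType) (m : nat) (A : set R) (u : R -> 'rV[R]_m) :
    \bar R :=
  ess_sup (@lebesgue_measure R) ((fun t => (enorm (u t))%:E) \_ A).

Definition signal (R : realType) (m : nat) : set (R -> 'rV[R]_m) :=
  [set u | lebesgue_measurable_signal u /\
           forall T : R, 0 < T -> (ess_sup_on `[0%R, T] u < +oo)%E].

Definition signal_norm (R : realType) (m : nat) (u : R -> 'rV[R]_m) : \bar R :=
  ess_sup_on `[0%R, +oo[ u.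

Definition abs_continuous (R : realType) (n : nat) (a b : R)
    (x : R -> 'rV[R]_n) : Prop :=
  forall e : R, 0 < e -> exists2 d : R, 0 < d &
    forall (k : nat) (s t : 'I_k -> R),
      (forall i, [/\ a <= s i, s i <= t i & t i <= b]) ->
      trivIset setT (fun i => `]s i, t i[%classic) ->
      \sum_(i < k) (t i - s i) < d ->
      \sum_(i < k) enorm (x (t i) - x (s i)) < e.

Definition segment (R : realType) (n : nat) (x : R -> 'rV[R]_n) (t : R) :
    R -> 'rV[R]_n :=
  fun tau => x (t + tau).

(* [x] is a solution on [-Delta, b), with [b] possibly infinite; its values
   outside [-Delta, b) are irrelevant. *)
Definition is_solution (R : realType) (Delta : R) (n m : nat)
    (f : (R -> 'rV[R]_n) -> 'rV[R]_m -> 'rV[R]_n)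
    (x0 : R -> 'rV[R]_n) (u : R -> 'rV[R]_m)
    (b : \bar R) (x : R -> 'rV[R]_n) : Prop :=
  [/\ (0%:E < b)%E,
      {within [set t : R | - Delta <= t /\ (t%:E < b)%E], continuous x},
      (forall tau : R, - Delta <= tau <= 0 -> x tau = x0 tau),
      (forall s t : R, 0 <= s -> s <= t -> (t%:E < b)%E ->
         abs_continuous s t x) &
      {ae @lebesgue_measure R, forall t : R, 0 <= t -> (t%:E < b)%E ->
         is_derive t (1 : R) x (f (segment x t) (u t))}].

Definition is_maximal_solution (R : realType) (Delta : R) (n m : nat)
    (f : (R -> 'rV[R]_n) -> 'rV[R]_m -> 'rV[R]_n)
    (x0 : R -> 'rV[R]_n) (u : R -> 'rV[R]_m)
    (b : \bar R) (x : R -> 'rV[R]_n) : Prop :=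
  is_solution Delta f x0 u b x /\
  forall (b' : \bar R) (x' : R -> 'rV[R]_n),
    is_solution Delta f x0 u b' x' ->
    (forall t : R, - Delta <= t -> (t%:E < b)%E -> (t%:E < b')%E ->
       x' t = x t) ->
    (b' <= b)%E.

(* "The corresponding solution has property P" is rendered as: a maximal
   solution exists, and every maximal solution has property P. *)
Definition robustly_forward_complete (R : realType) (Delta : R) (n m : nat)
    (f : (R -> 'rV[R]_n) -> 'rV[R]_m -> 'rV[R]_n) : Prop :=
  forall T r : R, 0 < T -> 0 < r ->
  exists2 rho : R, 0 < rho &
    forall (x0 : R -> 'rV[R]_n) (u : R -> 'rV[R]_m),
      hist Delta x0 -> signal u ->
      hist_norm Delta x0 <= r -> (signal_norm u <= r%:E)%E ->
      (exists b x, is_maximal_solution Delta f x0 u b x) /\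
      forall b x, is_maximal_solution Delta f x0 u b x ->
        (T%:E < b)%E /\
        (ereal_sup [set (enorm (x t))%:E | t in `[0%R, T]] <= rho%:E)%E.

(* Main.v *)
(** Truncating the vector field outside a large ball makes it bounded and globally
Lipschitz, so Picard iteration, contracting in the weight [expR (2 * L * t)],
gives a global solution of the truncated system. Since [V] along a solution is
continuous but not absolutely continuous while the history still contains the
merely continuous initial state, its growth is controlled by right Dini
derivatives: the driver derivative with input [u t] gives
[D+ v <= a * alpha (hist_norm x_t) + gamma r + c] for almost every [t], and with
input [0], together with the local Lipschitz continuity of [x], it gives a
uniform bound on [D+ v] for every [t]. As [alpha (enorm (x t)) <= v t], a
Gronwall comparison bounds [x] on [[0, T]]. Hence the truncated solution never
leaves the ball, solves the original system, and no maximal solution stops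
before [T]. *)

(* The final bound may depend on [r] and [T] only, whereas the Lipschitz and sup bounds of a given
   solution depend on that solution. Hence the two growth rates are kept apart. The almost
   everywhere rate involves only [r] and fixes the exponential. The everywhere rate involves the
   solution; it is used only on a null set [N], where it multiplies the increments of a monotone
   gauge growing at least at unit rate to the right of each point of [N], with arbitrarily small
   total increase. The second rate takes input [0] because [u t] is uncontrolled on [N]. The delayed
   term is not a function of [v t]: the maximum defining [hist_norm x_t] is attained at some past
   time, either in the initial history, where [alpha r] dominates, or at a later time [s], where
   [v s] dominates. The comparison is therefore with a bound of [v] on the whole of [[0, t]]. The a
   priori bound concerns the original system, which the truncated solution solves only while it
   stays in the ball. This circle is broken by advancing in time steps of fixed length, set by the
   Lipschitz constant of the truncated solution. *)
Require Import Defs.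
From mathcomp Require Import ring lra.

Set Implicit Arguments.
Unset Strict Implicit.
Unset Printing Implicit Defensive.
Import Order.TTheory GRing.Theory Num.Theory.

Local Open Scope classical_set_scope.
Local Open Scope ring_scope.
Local Notation mu := lebesgue_measure.

(** * Euclidean norm and histories *)

Section EuclideanNorm.
Variables (R : realType) (n : nat).
Implicit Types x y : 'rV[R]_n.

Lemma sqr_enorm x : enorm x ^+ 2 = \sum_(i < n) x ord0 i ^+ 2.
Proof. by rewrite sqr_sqrtr// sumr_ge0// => i _; exact: sqr_ge0. Qed.

Lemma enorm_ge0 x : 0 <= enorm x.
Proof. exact: sqrtr_ge0. Qed.

Lemma coord_le_enorm x i : `|x ord0 i| <= enorm x.
Proof.
rewrite -sqrtr_sqr ler_sqrt ?sumr_ge0// => [|j _]; last exact: sqr_ge0.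
by rewrite (bigD1 i)//= lerDl sumr_ge0// => j _; exact: sqr_ge0.
Qed.

Lemma enorm0 : enorm (0 : 'rV[R]_n) = 0.
Proof.
rewrite /enorm big1 ?sqrtr0// => i _; by rewrite mxE expr0n.
Qed.

Lemma enorm0_eq0 x : enorm x <= 0 -> x = 0.
Proof.
move=> x0; apply/rowP => i; rewrite mxE; apply/eqP; rewrite -normr_le0.
exact: le_trans (coord_le_enorm _ _) x0.
Qed.

Lemma enormZ (k : R) x : enorm (k *: x) = `|k| * enorm x.
Proof.
rewrite /enorm -sqrtr_sqr -sqrtrM ?sqr_ge0// mulr_sumr.
by congr Num.sqrt; apply: eq_bigr => i _; rewrite mxE exprMn.
Qed.

Lemma enormN x : enorm (- x) = enorm x.
Proof. by rewrite -scaleN1r enormZ normrN1 mul1r. Qed.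

Lemma enormBC x y : enorm (x - y) = enorm (y - x).
Proof. by rewrite -enormN opprB. Qed.

Lemma enorm_CauchySchwarz x y :
  \sum_(i < n) x ord0 i * y ord0 i <= enorm x * enorm y.
Proof.
have [x0|x0] := leP (enorm x) 0.
  rewrite (enorm0_eq0 x0) enorm0 mul0r big1// => i _; by rewrite mxE mul0r.
have [y0|y0] := leP (enorm y) 0.
  rewrite (enorm0_eq0 y0) enorm0 mulr0 big1// => i _; by rewrite mxE mulr0.
(* The expansion is [2 |x| |y| (|x| |y| - <x, y>)]; both norms are positive here, so the factor can
   be divided out. *)
have : 0 <= \sum_(i < n) (enorm y * x ord0 i - enorm x * y ord0 i) ^+ 2.
  by apply: sumr_ge0 => i _; exact: sqr_ge0.
rewrite (eq_bigr (fun i => enorm y ^+ 2 * (x ord0 i) ^+ 2 +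
    (- (2 * enorm x * enorm y) * (x ord0 i * y ord0 i) +
    enorm x ^+ 2 * (y ord0 i) ^+ 2))); last by move=> i _; ring.
rewrite !big_split/= -!mulr_sumr -!sqr_enorm.
set S := \sum_(i < n) _; move=> H.
have xy : 0 < enorm x * enorm y by rewrite mulr_gt0.
rewrite -(ler_pM2l xy); nra.
Qed.

Lemma ler_enormD x y : enorm (x + y) <= enorm x + enorm y.
Proof.
rewrite -ler_sqr ?nnegrE ?enorm_ge0 ?addr_ge0 ?enorm_ge0//.
rewrite sqr_enorm (eq_bigr (fun i => x ord0 i ^+ 2 +
   (2 * (x ord0 i * y ord0 i) + y ord0 i ^+ 2))); last first.
  by move=> i _; rewrite mxE; ring.
rewrite !big_split/= -mulr_sumr -!sqr_enorm.
have := enorm_CauchySchwarz x y; nra.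
Qed.

Lemma ler_enormB x y : enorm (x - y) <= enorm x + enorm y.
Proof. by rewrite -(enormN y) ler_enormD. Qed.

Lemma ler_enorm_trans x y z :
  enorm (x - z) <= enorm (x - y) + enorm (y - z).
Proof.
have -> : x - z = (x - y) + (y - z) by rewrite addrA subrK.
exact: ler_enormD.
Qed.

Lemma enorm_le_coord x (k : R) : (forall i, `|x ord0 i| <= k) ->
  enorm x <= n%:R * k.
Proof.
(* For [n = 0] the hypothesis is vacuous and [k] may be negative, but then [n%:R * k] vanishes. *)
move=> xk; have [n0|n0] := posnP n.
  have -> : n%:R * k = 0 by rewrite n0 mul0r.
  rewrite /enorm big1 ?sqrtr0// => i.
  by have := leq_ltn_trans (leq0n i) (ltn_ord i); rewrite [X in (_ < X)%N]n0.
have k0 : 0 <= k := le_trans (normr_ge0 _) (xk (Ordinal n0)).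
rewrite -ler_sqr ?nnegrE ?enorm_ge0 ?mulr_ge0//.
rewrite sqr_enorm (@le_trans _ _ (\sum_(i < n) k ^+ 2))//.
  apply: ler_sum => i _; rewrite -real_normK ?num_real//.
  by rewrite ler_sqr ?nnegrE.
rewrite sumr_const card_ord -[leLHS]mulr_natl exprMn.
by rewrite ler_wpM2r ?sqr_ge0// expr2 -natrM ler_nat leq_pmulr.
Qed.

Lemma norm_le_enorm x : `|x| <= enorm x.
Proof.
rewrite [leLHS]/Num.Def.normr/= mx_normrE (bigmax_le _ (enorm_ge0 _))//.
by move=> [i j] _; rewrite ord1 coord_le_enorm.
Qed.

Lemma coord_le_norm x i : `|x ord0 i| <= `|x|.
Proof.
rewrite [leRHS]/Num.Def.normr/= mx_normrE.
exact: (le_bigmax _ (fun i : 'I_1 * 'I_n => `|x i.1 i.2|) (ord0, i)).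
Qed.

Lemma enorm_le_norm x : enorm x <= n%:R * `|x|.
Proof. by apply: enorm_le_coord => i; exact: coord_le_norm. Qed.

End EuclideanNorm.

Lemma within_continuousP (R : realType) (A : set R) (V : normedModType R)
    (x : R -> V) : {within A, continuous x} <->
  forall t, A t -> forall e : R, 0 < e -> exists2 d : R, 0 < d &
    forall s, A s -> `|s - t| < d -> `|x s - x t| < e.
Proof.
split=> [/subspace_continuousP xc t At e e0|xc].
  have /cvgrPdist_lt/(_ e e0) := xc t At.
  rewrite near_withinE => /nbhs_ballP[d/= d0 H]; exists d => // s As st.
  by rewrite distrC; apply: H => //; rewrite /ball/= distrC.
apply/subspace_continuousP => t At; apply/cvgrPdist_lt => e e0.
rewrite near_withinE; apply/nbhs_ballP.
have [d d0 H] := xc t At e e0; exists d => //= s ts As.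
by rewrite distrC; apply: H => //; rewrite distrC.
Qed.

Lemma within_continuous_enormP (R : realType) (n : nat) (A : set R)
    (x : R -> 'rV[R]_n) : {within A, continuous x} <->
  forall t, A t -> forall e : R, 0 < e -> exists2 d : R, 0 < d &
    forall s, A s -> `|s - t| < d -> enorm (x s - x t) < e.
Proof.
split=> [/within_continuousP xc t At e e0|xc].
  (* The norms differ by a factor of at most [n]; adding 1 keeps the denominator positive when
     [n = 0]. *)
  have e1 : 0 < e / (n%:R + 1) by rewrite divr_gt0// ltr_wpDl.
  have [d d0 H] := xc t At _ e1; exists d => // s As st.
  apply: le_lt_trans (enorm_le_norm _) _.
  have := H s As st; rewrite ltr_pdivlMr ?ltr_wpDl//.
  have := normr_ge0 (x s - x t); set N := `|_|; move=> N0 N1.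
  have [N00|N00] := leP N 0; first by rewrite (@le_lt_trans _ _ 0)// mulr_ge0_le0.
  by rewrite (lt_trans _ N1)// mulrC ltr_pM2l// ltrDl.
apply/within_continuousP => t At e e0.
have [d d0 H] := xc t At e e0; exists d => // s As st.
exact: le_lt_trans (norm_le_enorm _) (H s As st).
Qed.

Lemma within_continuous_enorm (R : realType) (n : nat) (A : set R)
    (x : R -> 'rV[R]_n) : {within A, continuous x} ->
  {within A, continuous (fun t => enorm (x t))}.
Proof.
move=> /within_continuous_enormP xc; apply/within_continuousP => t At e e0.
have [d d0 H] := xc t At e e0; exists d => // s As st.
apply: le_lt_trans (H s As st).
have := ler_enormD (x s - x t) (x t); have := ler_enormD (x t - x s) (x s).
rewrite !subrK enormBC ler_norml; lra.
Qed.

Section HistNorm.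
Variables (R : realType) (Delta : R) (n : nat).
Hypothesis Delta0 : 0 <= Delta.
Implicit Types phi psi : R -> 'rV[R]_n.

Lemma hist_norm_le phi (k : R) :
  (forall s, - Delta <= s <= 0 -> enorm (phi s) <= k) -> hist_norm Delta phi <= k.
Proof.
move=> H; apply: ge_sup.
  by exists (enorm (phi 0)), 0 => //=; rewrite in_itv/= lexx oppr_le0 Delta0.
by move=> _ [s /= + <-]; rewrite in_itv/=; exact: H.
Qed.

(** Continuity matters: [sup] of an unbounded set is the default value 0, so [hist_norm] dominates
    the pointwise norms only once the maximum is known to exist. *)
Lemma hist_norm_attained phi : hist Delta phi ->
  exists2 s, - Delta <= s <= 0 & hist_norm Delta phi = enorm (phi s) /\
    forall t, - Delta <= t <= 0 -> enorm (phi t) <= enorm (phi s).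
Proof.
move=> /within_continuous_enorm hphi.
have [|s] := EVT_max _ hphi; first by rewrite oppr_le0.
rewrite in_itv/= => sD smax; have smax' t : - Delta <= t <= 0 -> enorm (phi t) <= enorm (phi s).
  by move=> tD; apply: smax; rewrite in_itv.
exists s => //; split=> //; apply/eqP; rewrite eq_le hist_norm_le//=.
apply: ub_le_sup; last by exists s => //=; rewrite in_itv.
by exists (enorm (phi s)) => _ [t /= + <-]; rewrite in_itv/=; exact: smax'.
Qed.

Lemma enorm_le_hist_norm phi s : hist Delta phi -> - Delta <= s <= 0 ->
  enorm (phi s) <= hist_norm Delta phi.
Proof. by move=> /hist_norm_attained[t _ [-> H]] /H. Qed.

Lemma hist_norm_ge0 phi : hist Delta phi -> 0 <= hist_norm Delta phi.
Proof. by move=> /hist_norm_attained[t _ [-> _]]; exact: enorm_ge0. Qed.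

End HistNorm.

Lemma hist0 (R : realType) (Delta : R) n : hist Delta (0 : R -> 'rV[R]_n).
Proof.
apply/within_continuous_enormP => t _ e e0; exists 1 => // s _ _.
by rewrite subrr enorm0.
Qed.

(** * Absolutely continuous functions *)

(** Continuous induction on the set of times where the inequality from [p] holds. Its supremum
    belongs to it by continuity of [z] and monotonicity of [psi], which may jump upwards; the local
    hypothesis then pushes the supremum up to [q]. *)
Lemma right_increment_le (R : realType) (z psi : R -> R) (p q : R) :
  p <= q -> {within `[p, q], continuous z} ->
  (forall s t, p <= s -> s <= t -> t <= q -> psi s <= psi t) ->
  (forall t, p <= t -> t < q -> exists2 d, 0 < d &
     forall h, 0 < h -> h < d -> t + h <= q ->
       z (t + h) - z t <= psi (t + h) - psi t) ->
  z q - z p <= psi q - psi p.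
Proof.
move=> pq /within_continuousP zc psi_nd step.
pose S := [set t | p <= t <= q /\ z t - z p <= psi t - psi p].
have Sp : S p by split; rewrite ?lexx//= !subrr.
have Sub : ubound S q by move=> t [/andP[]].
have hS : has_sup S by split; [exists p | exists q].
have ptau : p <= sup S by apply: ub_le_sup => //; exists q.
have tauq : sup S <= q by apply: ge_sup => //; exists p.
have Stau : S (sup S).
  split; first exact/andP.
  apply/ler_addgt0Pr => e e0.
  have [|d d0 H] := zc (sup S) _ e e0; first by rewrite /= in_itv/= ptau.
  have [t [/andP[pt tq] zt] dt] := sup_adherent d0 hS.
  have tsup : t <= sup S by apply: ub_le_sup; [exists q | split => //; exact/andP].
  have := psi_nd t (sup S) pt tsup tauq.
  have := H t; rewrite /= in_itv/= pt tq ler0_norm; last by rewrite subr_le0.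
  move=> /(_ isT); rewrite ltr_norml => H'.
  have /H' /andP[]: - (t - sup S) < d by lra.
  lra.
suff : ~ (sup S < q).
  by move/negP; rewrite -leNgt => qtau; have /eqP -> : q == sup S;
    [rewrite eq_le qtau tauq | case: Stau].
move=> tq; have [d d0 H] := step _ ptau tq.
pose h := Num.min (d / 2) (q - sup S).
have h0 : 0 < h by rewrite lt_min divr_gt0//= subr_gt0.
have hd : h < d by rewrite gt_min; apply/orP; left; lra.
have hq : sup S + h <= q.
  have : h <= q - sup S by rewrite ge_min lexx orbT.
  lra.
have : S (sup S + h).
  split; first by rewrite hq andbT; lra.
  have := H h h0 hd hq; case: Stau => _; lra.
by move=> /(ub_le_sup (ex_intro _ q Sub)); lra.
Qed.

Lemma ae_imply (R : realType) (P Q : R -> Prop) : (forall t, P t -> Q t) ->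
  {ae @mu R, forall t, P t} -> {ae @mu R, forall t, Q t}.
Proof. by move=> PQ aeP; apply: negligibleS aeP => t /= nQ Pt; exact/nQ/PQ. Qed.

Lemma ae_imply2 (R : realType) (P Q S : R -> Prop) :
  (forall t, P t -> Q t -> S t) -> {ae @mu R, forall t, P t} ->
  {ae @mu R, forall t, Q t} -> {ae @mu R, forall t, S t}.
Proof.
move=> PQS aeP aeQ; apply: negligibleS (negligibleU aeP aeQ) => t /= nS.
by apply/not_andP => -[Pt Qt]; exact/nS/PQS.
Qed.

Lemma ae_forall_nat (R : realType) (P : nat -> R -> Prop) :
  (forall k, {ae @mu R, forall t, P k t}) -> {ae @mu R, forall t, forall k, P k t}.
Proof.
move=> aeP; apply: negligibleS (negligible_bigcup aeP) => t /= /existsNP[k Pk].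
by exists k.
Qed.

Lemma ae_forall_ord (R : realType) (n : nat) (P : 'I_n -> R -> Prop) :
  (forall i, {ae @mu R, forall t, P i t}) -> {ae @mu R, forall t, forall i, P i t}.
Proof.
move=> aeP; have : forall k, {ae @mu R, forall t, forall i : 'I_n, i = k :> nat -> P i t}.
  move=> k; have [kn|nk] := ltnP k n.
    apply: ae_imply (aeP (Ordinal kn)) => t Pt i ik.
    by have -> : i = Ordinal kn by exact: val_inj.
  by apply: aeW => t i ik; move: (ltn_ord i); rewrite ik ltnNge nk.
by move=> /ae_forall_nat; apply: ae_imply => t H i; exact: H.
Qed.

Lemma ae_neq (R : realType) (p : R) : {ae @mu R, forall t, t != p}.
Proof.
exists [set p]; split; [exact: measurable_set1|exact: lebesgue_measure_set1|].
by move=> t /= /negP; rewrite negbK => /eqP.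
Qed.

Lemma le_lebesgue_measure (R : realType) (A B : set R) :
  measurable A -> measurable B -> A `<=` B -> (mu A <= mu B)%E.
Proof. by move=> mA mB AB; apply: le_measure => //; rewrite inE. Qed.

Lemma lebesgue_measureU (R : realType) (A B : set R) :
  measurable A -> measurable B -> A `&` B = set0 ->
  mu (A `|` B) = (mu A + mu B)%E.
Proof. by move=> mA mB AB; apply: (@measureU _ _ _ (@lebesgue_measure R)). Qed.

(** Outer regularity gives an open [U] containing [N] of measure at most [d], and [phi t] is the
    measure of the part of [U] up to [t]. Around a point of [N] the set [U] contains an interval, so
    [phi] grows there at unit rate. *)
Lemma negligible_gauge (R : realType) (N : set R) (d : R) :
  (@mu R).-negligible N -> 0 < d ->
  exists phi : R -> R, [/\ {homo phi : s t / s <= t},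
    forall t, 0 <= phi t <= d &
    forall t, N t -> exists2 e, 0 < e &
      forall h, 0 < h -> h < e -> h <= phi (t + h) - phi t].
Proof.
move=> [B [mB B0 NB]] d0.
have [|U [oU BU Ud]] := lebesgue_regularity_outer mB _ d0.
  by rewrite [X in (X < _)%E]B0 ltry.
have mU : measurable U by exact: open_measurable.
have muU : (mu U <= d%:E)%E.
  rewrite -(setDUK BU) measureU//; [|exact: measurableD|by rewrite setDIK].
  by rewrite [X in (X + _)%E]B0 add0e ltW.
have mUt t : measurable (U `&` `]-oo, t]) by exact: measurableI.
have Ut t : (mu (U `&` `]-oo, t]) <= d%:E)%E.
  by apply: le_trans muU; exact: le_lebesgue_measure.
have fUt t : mu (U `&` `]-oo, t]) \is a fin_num.
  by rewrite ge0_fin_numE// (le_lt_trans (Ut t))// ltry.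
exists (fun t => fine (mu (U `&` `]-oo, t]))); split.
- move=> s t st; rewrite fine_le//; apply: le_lebesgue_measure => //.
  by apply: setIS; apply: subset_itvl; rewrite bnd_simp.
- by move=> t; rewrite fine_ge0//= -lee_fin fineK.
- move=> t /NB/BU Utt; have /nbhs_ballP[e/= e0 H] := open_nbhs_nbhs (conj oU Utt).
  exists e => // h h0 he.
  have sub : `]t, t + h] `<=` U.
    move=> s /=; rewrite in_itv/= => /andP[ts sth]; apply: H.
    by rewrite /ball/= ltr_norml; apply/andP; split; lra.
  rewrite lerBrDl -lee_fin EFinD !fineK//.
  have -> : h%:E = mu `]t, t + h].
    by rewrite lebesgue_measure_itv/= lte_fin ltrDl h0 -EFinB addrC addKr.
  have disj : U `&` `]-oo, t] `&` `]t, t + h] = set0.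
    apply/seteqP; split => // s [[_ /=]]; rewrite !in_itv/= => st /andP[].
    by rewrite ltNge st.
  have mth : measurable (`]t, t + h] : set R) by [].
  have <- : mu (U `&` `]-oo, t] `|` `]t, t + h]) = (mu (U `&` `]-oo, t]) + mu `]t, (t + h)%R])%E.
    exact: lebesgue_measureU.
  apply: le_lebesgue_measure => //; first exact: measurableU.
  move=> s [[Us /=]|/= sth].
    by rewrite !in_itv/= => st; split => //=; rewrite ?in_itv/=; lra.
  split; first exact: sub.
  by move: sth; rewrite /= !in_itv/= => /andP[].
Qed.

Section AbsoluteContinuity.
Variables (R : realType) (n : nat).
Implicit Types (x y : R -> 'rV[R]_n) (a b p q : R).

Lemma abs_continuousW x a b p q : a <= p -> q <= b ->
  abs_continuous a b x -> abs_continuous p q x.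
Proof.
move=> ap qb ac e e0; have [d d0 H] := ac e e0; exists d => // k s t st.
by apply: H => i; have [? ? ?] := st i; split => //; lra.
Qed.

Lemma abs_continuousB x y a b : abs_continuous a b x -> abs_continuous a b y ->
  abs_continuous a b (fun t => x t - y t).
Proof.
move=> acx acy e e0; have e2 : 0 < e / 2 by rewrite divr_gt0.
have [d d0 H] := acx _ e2; have [d' d'0 H'] := acy _ e2.
exists (Num.min d d'); first by rewrite lt_min d0.
move=> k s t st tri; rewrite lt_min => /andP[{}/H H {}/H' H'].
have := ltrD (H st tri) (H' st tri); rewrite -splitr; apply: le_lt_trans.
rewrite -big_split/=; apply: ler_sum => i _.
have -> : x (t i) - y (t i) - (x (s i) - y (s i)) =
  (x (t i) - x (s i)) - (y (t i) - y (s i)) by rewrite !opprD !opprK addrACA.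
exact: ler_enormB.
Qed.

Lemma eq_abs_continuous x y a b : (forall t, a <= t -> t <= b -> x t = y t) ->
  abs_continuous a b x -> abs_continuous a b y.
Proof.
move=> xy acx e e0; have [d d0 H] := acx _ e0; exists d => // k s t st tri sd.
have := H k s t st tri sd; congr (_ < _); apply: eq_bigr => i _.
by have [? ? ?] := st i; rewrite !xy//; lra.
Qed.

Lemma lipschitz_abs_continuous x a b (M : R) :
  (forall s t, a <= s -> s <= t -> t <= b -> enorm (x t - x s) <= M * (t - s)) ->
  abs_continuous a b x.
Proof.
move=> xM e e0; pose M' := Num.max M 1.
have M'0 : 0 < M' by rewrite lt_max ltr01 orbT.
exists (e / M'); first by rewrite divr_gt0.
move=> k s t st _; rewrite ltr_pdivlMr// mulrC; apply: le_lt_trans.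
rewrite mulr_sumr; apply: ler_sum => i _; have [? ? ?] := st i.
apply: le_trans (xM _ _ _ _ _) _ => //; rewrite ler_wpM2r ?subr_ge0//.
by rewrite le_max lexx.
Qed.

(** Increasing lists replace disjoint indexed families, so that a new interval can simply be
    appended on the right. *)
Lemma abs_continuous_seq x a b (e : R) : abs_continuous a b x -> 0 < e ->
  exists2 d, 0 < d & forall l : seq (R * R),
    pairwise (fun i j => i.2 <= j.1) l ->
    (forall i, i \in l -> [/\ a <= i.1, i.1 <= i.2 & i.2 <= b]) ->
    \sum_(i <- l) (i.2 - i.1) < d -> \sum_(i <- l) enorm (x i.2 - x i.1) < e.
Proof.
move=> ac e0; have [d d0 H] := ac e e0; exists d => // l lp lab.
rewrite !(big_nth (0, 0)) !big_mkord.
apply: (H (size l) (fun i => (nth (0, 0) l i).1) (fun i => (nth (0, 0) l i).2)).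
  by move=> i; apply: lab; exact: mem_nth.
have sep (i j : 'I_(size l)) : (i < j)%N ->
    (nth (0, 0) l i).2 <= (nth (0, 0) l j).1.
  by move=> ij; move/(pairwiseP (0, 0)) : lp => /(_ i j); rewrite !inE => ->.
move=> i j _ _ [u/= []]; rewrite !in_itv/= => /andP[iu ui] /andP[ju uj].
apply: val_inj; apply/eqP; case: ltngtP => //= /sep; lra.
Qed.

Lemma abs_continuous_within x p q : abs_continuous p q x ->
  {within `[p, q], continuous x}.
Proof.
move=> ac; apply/within_continuous_enormP => t; rewrite /= in_itv/= => /andP[pt tq] e e0.
have [d d0 H] := abs_continuous_seq ac e0; exists d => // s.
rewrite in_itv/= => /andP[ps sq] st.
have [ts|ts] := leP t s.
  have := H [:: (t, s)]; rewrite !big_seq1/=; apply=> //.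
    by move=> i; rewrite inE => /eqP ->.
  by rewrite -(ger0_norm (_ : 0 <= s - t)) ?subr_ge0.
have := H [:: (s, t)]; rewrite !big_seq1/= enormBC; apply=> //.
  by move=> i; rewrite inE => /eqP ->/=; split=> //; exact: ltW.
by rewrite -(ger0_norm (_ : 0 <= t - s)) ?subr_ge0 1?ltW// distrC.
Qed.

(* The exceptional null set is covered by intervals of small total length, over
   which the variation of [x] is small; this variation is added to [psi]. *)
Lemma abs_continuous_growth x psi p q : p <= q -> abs_continuous p q x ->
  (forall s t, p <= s -> s <= t -> t <= q -> psi s <= psi t) ->
  {ae @mu R, forall t, p <= t -> t < q ->
     forall e : R, 0 < e -> exists2 d, 0 < d &
     forall h, 0 < h -> h < d -> t + h <= q ->
       enorm (x (t + h) - x t) <= psi (t + h) - psi t + e * h} ->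
  enorm (x q - x p) <= psi q - psi p.
Proof.
move=> pq ac psi_nd; set P := (fun t => _); move=> aeP.
suff : forall e, 0 < e -> enorm (x q - x p) <= psi q - psi p + (e * (q - p) + e).
  move=> H; apply/ler_addgt0Pr => e e0.
  have k0 : 0 < q - p + 1 by lra.
  have := H (e / (q - p + 1)); rewrite divr_gt0// => /(_ isT).
  by rewrite -{2}(mulr1 (e / _)) -mulrDr divfK ?gt_eqF.
move=> e e0; have [d d0 H] := abs_continuous_seq ac e0.
have d2 : 0 < d / 2 by rewrite divr_gt0.
have [phi [phi_nd phi_d phiN]] := negligible_gauge aeP d2.
(* Interval families in [[p, t]] whose total length fits into the gauge [phi t]. Since
   [phi t <= d / 2 < d], absolute continuity bounds the variation of [x] over each of them by [e];
   [W t] is the supremum of these variations. *)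
pose valid t (l : seq (R * R)) := [/\ pairwise (fun i j : R * R => i.2 <= j.1) l,
  (forall i, i \in l -> [/\ p <= i.1, i.1 <= i.2 & i.2 <= t]) &
  \sum_(i <- l) (i.2 - i.1) <= phi t].
pose A t := [set \sum_(i <- l) enorm (x i.2 - x i.1) | l in valid t].
have valid0 t : valid t [::].
  by split => //; rewrite big_nil; have /andP[] := phi_d t.
have Ae t : t <= q -> ubound (A t) e.
  move=> tq _ [l [lp lv lphi] <-]; apply/ltW/H => //.
    by move=> i /lv[? ? ?]; split => //; lra.
  by apply: le_lt_trans lphi _; have /andP[_] := phi_d t; lra.
have A0 t : A t !=set0 by exists (\sum_(i <- [::]) enorm (x i.2 - x i.1)), [::].
pose W t := sup (A t).
have W0 t : t <= q -> 0 <= W t.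
  move=> tq; apply: ub_le_sup; first by exists e; exact: Ae.
  by exists [::] => //; rewrite big_nil.
have We t : t <= q -> W t <= e by move=> tq; apply: ge_sup => //; exact: Ae.
have W_nd s t : s <= t -> t <= q -> W s <= W t.
  move=> st tq; apply: ge_sup => // _ [l [lp lv lphi] <-].
  apply: ub_le_sup; first by exists e; exact: Ae.
  exists l => //; split => //; last exact: le_trans (phi_nd _ _ st).
  by move=> i /lv[? ? ?]; split => //; lra.
have xc := abs_continuous_within ac.
have zc : {within `[p, q], continuous (fun t => enorm (x t - x p))}.
  apply: within_continuous_enorm; apply/within_continuous_enormP.
  move=> t tpq r r0; have [d' d'0 H'] := (within_continuous_enormP _ _).1 xc t tpq r r0.
  exists d' => // s spq st.
  have -> : x s - x p - (x t - x p) = x s - x t by rewrite opprD opprK addrACA addNr addr0.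
  exact: H'.
have := @right_increment_le _ (fun t => enorm (x t - x p))
  (fun t => psi t + (e * t + W t)) p q pq zc.
rewrite subrr enorm0 subr0 => H1.
have psiW_nd s t : p <= s -> s <= t -> t <= q ->
    psi s + (e * s + W s) <= psi t + (e * t + W t).
  move=> ps st tq; have := psi_nd s t ps st tq; have := W_nd s t st tq.
  by move: (ler_wpM2l (ltW e0) st); lra.
suff step : forall t, p <= t -> t < q -> exists2 d, 0 < d &
    forall h, 0 < h -> h < d -> t + h <= q ->
    enorm (x (t + h) - x p) - enorm (x t - x p) <=
    psi (t + h) + (e * (t + h) + W (t + h)) - (psi t + (e * t + W t)).
  by move: (H1 psiW_nd step) (We q (lexx q)) (W0 p pq); lra.
move=> t pt tq; have inc h : enorm (x (t + h) - x p) - enorm (x t - x p) <=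
    enorm (x (t + h) - x t) by rewrite lerBlDr ler_enorm_trans.
have [Pt|NPt] := pselect (P t).
  have [d' d'0 H'] := Pt pt tq e e0; exists d' => // h h0 hd thq.
  have := H' h h0 hd thq; have := inc h.
  have : W t <= W (t + h) by apply: W_nd => //; lra.
  lra.
have [d' d'0 H'] := phiN t NPt; exists d' => // h h0 hd thq.
(* At an exceptional [t] the gauge gains at least [h], so the interval from [t] to [t + h] can be
   appended to any family admissible at [t]. *)
suff : W t + enorm (x (t + h) - x t) <= W (t + h).
  have tth : t <= t + h by lra.
  have eh : 0 < e * h by rewrite mulr_gt0.
  by move: (inc h) (psi_nd t (t + h) pt tth thq); lra.
rewrite -lerBrDr; apply: ge_sup => // _ [l [lp lv lphi] <-]; rewrite lerBrDr.
apply: ub_le_sup; first by exists e; exact: Ae.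
exists (rcons l (t, t + h)); last by rewrite -cats1 big_cat big_seq1.
split.
- rewrite -cats1 pairwise_cat lp/= andbT; apply/allrelP => i j /lv[_ _ it].
  by rewrite inE => /eqP ->.
- move=> i; rewrite mem_rcons inE => /predU1P[->/=|/lv[? ? ?]]; split=> //; lra.
- rewrite -cats1 big_cat big_seq1/=; have := H' h h0 hd; lra.
Qed.

End AbsoluteContinuity.

(** * Antiderivatives and completed measurability *)

(** [G] is the integral over []0, t]], differentiable almost everywhere by Lebesgue differentiation.
    The domain is empty for [t <= 0], hence derivatives are claimed only at positive times. *)
Lemma bounded_antiderivative (R : realType) (h : R -> R) (M : R) :
  measurable_fun setT h -> (forall t, `|h t| <= M) ->
  exists G : R -> R, [/\ G 0 = 0,
    (forall s t : R, 0 <= s -> s <= t -> `|G t - G s| <= M * (t - s)) &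
    {ae @mu R, forall t : R, 0 < t -> is_derive t 1 G (h t)}].
Proof.
move=> mh hM.
have hbnd A : [bounded h x | x in A].
  exists M; split; first by rewrite num_real.
  by move=> K MK x _; exact: le_trans (hM x) (ltW MK).
have inth (A : set R) : measurable A -> (@mu R A < +oo)%E ->
    (@mu R).-integrable A (EFin \o h).
  move=> mA Aoo; apply: measurable_bounded_integrable => //.
  exact: measurable_funTS.
have itv_fin s t : (@mu R `]s, t] < +oo)%E.
  by rewrite lebesgue_measure_itv/=; case: ifP => _; rewrite ltry.
exists (fun x => (\int[@mu R]_(t in [set` Interval (BRight 0) (BRight x)]) h t)).
split.
- by rewrite set_itvxx Rintegral_set0.
- move=> s t s0 st; have it0 : (@mu R).-integrable `]0, t] (EFin \o h).
    by apply: inth => //; exact: itv_fin.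
  rewrite (Rintegral_itvB it0) ?bnd_simp//.
  have ih := inth `]s, t]%classic (measurable_itv _) (itv_fin s t).
  apply: le_trans (le_normr_Rintegral _ ih) _ => //.
  apply: (@le_trans _ _ (\int[@mu R]_(x in `]s, t]) M)).
    apply: le_Rintegral => //.
    - apply/integrable_norm; exact: ih.
    - apply: measurable_bounded_integrable => //; first exact: itv_fin.
      exists `|M|; split; first by rewrite num_real.
      by move=> K MK x _; exact: ltW.
  have mst : @mu R `]s, t] = (t - s)%:E.
    rewrite lebesgue_measure_itv/= lte_fin; case: ltP => // ts.
    by rewrite (@le_anti _ _ s t) ?st// subrr.
  by rewrite Rintegral_cst// [X in fine X]mst.
- have /FTC1 : forall y : R, (@mu R).-integrable [set` Interval (BRight 0) (BRight y)] (EFin \o h).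
    by move=> y; apply: inth => //; exact: itv_fin.
  have loc : locally_integrable [set: R] h.
    split => //; first exact: openT.
    move=> K _ cK; have := inth K (compact_measurable cK) (compact_finite_measure cK).
    by move=> /integrableP[].
  move=> /(_ loc); apply: ae_imply => t H t0.
  have [|d e] := H; first exact: t0.
  by apply: DeriveDef; [exact: d | rewrite -derive1E; exact: e].
Qed.

Section CompletedMeasurability.
Variable R : realType.

Local Notation lebesgueType :=
  (g_sigma_algebraType (completed_algebra_gen (@lebesgue_measure R))).

Lemma completed_measurable (A : set R) :
  measurable A -> measurable (A : set lebesgueType).
Proof.
move=> mA; apply: sub_sigma_algebra; exists A => //.
by exists set0; [exact: negligible_set0 | rewrite setU0].
Qed.

(** Bridges Lebesgue measurable signals and integration of Borel functions. Each sublevel set at a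
    rational level is a Borel set up to a null set; these countably many null sets lie in one Borel
    null set [N], and [g] is Borel off [N]. Setting [h] to 0 elsewhere lets bounds on [g] carry over
    to [h]. *)
Lemma borel_ae_version (g : lebesgueType -> R) :
  measurable_fun (`[0, +oo[ : set lebesgueType) g ->
  exists h : R -> R, [/\ measurable_fun setT h,
    forall t, h t = 0 \/ 0 <= t /\ h t = g t &
    {ae @mu R, forall t : R, 0 <= t -> h t = g t}].
Proof.
move=> mg; pose L (q : R) : set R := `[0, +oo[ `&` [set t | g t < q].
have LE (q : R) : exists AN : set R * set R, [/\ measurable AN.1,
    (@mu R).-negligible AN.2 & AN.1 `|` AN.2 = L q].
  have : (completed_algebra_gen (@lebesgue_measure R)).-sigma.-measurable (L q).
    have -> : L q = `[0, +oo[ `&` g @^-1` `]-oo, q[%classic.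
      by apply/seteqP; split => t [t0 /=]; rewrite ?in_itv//= => tq; split.
    by apply: mg => //; exact: completed_measurable.
  rewrite g_sigma_completed_algebra_genE => -[A mA [N NN] AN].
  by exists (A, N).
have [AN ANE] := choice LE.
have /negligible_bigcup : forall k : nat, (@mu R).-negligible
    (if unpickle k is Some q then (AN (ratr (q : rat))).2 else set0).
  by move=> k; case: unpickle => [q|]; [have [] := ANE (ratr q) | exact: negligible_set0].
set N0 := \bigcup_k _; move=> [N [mN N_0 N0N]].
have NsubN q : (AN (ratr (q : rat))).2 `<=` N.
  by move=> t tN; apply/N0N; exists (pickle q); [exact: I | rewrite pickleK; exact: tN].
pose D : set R := `[0, +oo[ `\` N.
have mD : measurable D by exact: measurableD.
exists (fun t => if t \in D then g t else 0); split.
- apply: (measurability _ (RGenInftyO.measurableE R)) => _ [_ [r ->] <-].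
  rewrite setTI.
  have -> : (fun t => if t \in D then g t else 0) @^-1` `]-oo, r[ =
     (\bigcup_(q in [set q : rat | ratr q < r]) ((AN (ratr q)).1 `&` D)) `|`
     (if 0 < r then ~` D else set0).
    apply/seteqP; split => t /=.
      rewrite in_itv/=; case: ifPn => [|]; rewrite ?notin_setE ?inE => tD.
        move=> gr; left; have [q] := rat_in_itvoo gr.
        rewrite in_itv/= => /andP[gq qr]; exists q => //; split => //.
        have : L (ratr q) t by split=> //; case: tD.
        have [_ _ <-] := ANE (ratr q); case=> // /NsubN.
        by case: tD.
      by move=> r0; right; rewrite r0.
    rewrite in_itv/= => -[[q qr [At Dt]]|].
      rewrite ifT ?inE//; apply: lt_trans qr.
      have : L (ratr q) t by have [_ _ <-] := ANE (ratr q); left.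
      by case.
    by case: ltP => // r0 tD; rewrite ifF//; apply/negbTE; rewrite notin_setE.
  apply: measurableU; last by case: ifP => _ //; exact: measurableC.
  rewrite bigcup_mkcond; apply: bigcupT_measurable_rat => q; case: ifP => // _.
  by apply: measurableI; [have [] := ANE (ratr q) | exact: mD].
- move=> t; case: ifPn; rewrite ?inE => tD; [right|by left].
  by split => //; case: tD; rewrite /= in_itv/= andbT.
- exists N; split => // t /= /not_implyP[t0]; case: ifPn => //.
  by rewrite notin_setE => /not_andP[|/contrapT//]; rewrite /= in_itv/= andbT.
Qed.

(* Freezing the first argument of [Phi] on a grid of mesh [1 / (j + 1)] gives
   measurable functions that converge pointwise to the diagonal. *)
Lemma measurable_diagonal (Phi : R -> lebesgueType -> R) :
  (forall tau : R, 0 <= tau ->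
     measurable_fun (`[0, +oo[ : set lebesgueType) (Phi tau)) ->
  (forall t : R, 0 <= t -> forall e : R, 0 < e -> exists2 d : R, 0 < d &
     forall tau : R, 0 <= tau -> tau <= t -> t - tau < d ->
       `|Phi tau t - Phi t t| < e) ->
  measurable_fun (`[0, +oo[ : set lebesgueType) (fun t => Phi t t).
Proof.
move=> mPhi cPhi.
pose grid (j : nat) (t : R) : R := (Num.truncn (t * j.+1%:R))%:R / j.+1%:R.
have gridP j t : 0 <= t -> [/\ 0 <= grid j t, grid j t <= t & t - grid j t < j.+1%:R^-1].
  move=> t0; have j0 : 0 < j.+1%:R :> R by rewrite ltr0n.
  have /andP[le gt] := truncn_itv (mulr_ge0 t0 (ltW j0)).
  split; first by rewrite divr_ge0.
    by rewrite ler_pdivrMr.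
  rewrite ltrBlDr -[X in X + _]mul1r -mulrDl ltr_pdivlMr//.
  by rewrite addrC natr1.
apply: (@measurable_fun_cvg _ lebesgueType R _ (fun j t => Phi (grid j t) t)); last first.
  move=> t; rewrite /= in_itv/= andbT => t0; apply/cvgrPdist_lt => e e0.
  have [d d0 H] := cPhi t t0 e e0.
  near=> j; rewrite distrC; have [g0 gt tg] := gridP j t t0; apply: H => //.
  apply: lt_trans tg _; near: j; exact: (near_infty_natSinv_lt (PosNum d0)).
move=> j; pose E (k : nat) : set lebesgueType := [set` `[k%:R / j.+1%:R, k.+1%:R / j.+1%:R[].
have j0 : 0 < j.+1%:R :> R by rewrite ltr0n.
have EU : (`[0, +oo[%classic : set lebesgueType) = \bigcup_k E k.
  apply/seteqP; split => t /=.
    rewrite in_itv/= andbT => t0; exists (Num.truncn (t * j.+1%:R)) => //.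
    rewrite /E/= in_itv/= ler_pdivrMr// ltr_pdivlMr//.
    exact: truncn_itv (mulr_ge0 t0 (ltW j0)).
  by move=> [k _]; rewrite /E/= !in_itv/= andbT => /andP[+ _]; apply: le_trans; rewrite divr_ge0.
have mE k : measurable (E k) by apply: completed_measurable; exact: measurable_itv.
rewrite EU; apply/(measurable_fun_bigcup _ mE) => k.
apply: (@eq_measurable_fun _ _ _ _ _ (Phi (k%:R / j.+1%:R))).
  move=> t; rewrite inE /E/= in_itv/= ler_pdivrMr// ltr_pdivlMr// => tk.
  by rewrite /grid (truncn_def tk).
apply: (measurable_funS _ _ (mPhi _ _)).
- by apply: completed_measurable; exact: measurable_itv.
- by rewrite EU; exact: bigcup_sup.
- by rewrite divr_ge0.
Unshelve. all: by end_near. Qed.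

End CompletedMeasurability.

(** * Growth from derivatives *)

Section VectorDerivative.
Variables (R : realType) (n : nat).
Implicit Types (x z : R -> 'rV[R]_n) (w : 'rV[R]_n).

Lemma is_derive_enorm x (t : R) w : is_derive t (1 : R) x w ->
  forall e : R, 0 < e -> exists2 d : R, 0 < d & forall h, `|h| < d ->
    enorm (x (t + h) - x t - h *: w) <= e * `|h|.
Proof.
move=> [dx xw] e e0.
have e1 : 0 < e / (n%:R + 1) by rewrite divr_gt0// ltr_wpDl.
have := derivable_nbhs dx; rewrite xw => /eqaddoP /(_ _ e1) /nbhs_ballP[d/= d0 H].
exists d => // h hd.
have hn : h%:A = h :> R by rewrite [h%:A]mulr1.
have {H} := H h; rewrite /ball/= sub0r normrN !fctE/= => /(_ hd).
rewrite hn (addrC h t) => H.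
apply: le_trans (enorm_le_norm _) _.
rewrite opprD addrA in H.
apply: (@le_trans _ _ (n%:R * (e / (n%:R + 1) * `|h|))); first by rewrite ler_wpM2l.
rewrite mulrA ler_wpM2r//.
by rewrite mulrCA ger_pMr// ler_pdivrMr ?ltr_wpDl// mul1r lerDl.
Qed.

Lemma is_derive_row x (t : R) w :
  (forall i, is_derive t (1 : R) (fun s => x s ord0 i) (w ord0 i)) ->
  is_derive t (1 : R) x w.
Proof.
move=> H; have dx : derivable x t 1.
  by apply/derivable_mxP => i j; rewrite ord1; have [] := H j.
apply: DeriveDef => //; rewrite derive_mx//.
by apply/matrixP => i j; rewrite mxE !ord1; have [] := H j.
Qed.

Lemma is_derive_local x z (t d : R) w : 0 < d ->
  (forall s, `|s - t| < d -> x s = z s) ->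
  is_derive t (1 : R) x w -> is_derive t (1 : R) z w.
Proof.
move=> d0 xz; apply: near_eq_is_derive.
by apply/nbhs_ballP; exists d => //= s; rewrite /ball/= distrC; exact: xz.
Qed.

(** The comparison function [psi] is controlled by its increments, so exponentials enter through
    [expR_ge1Dx] alone and [psi] is never differentiated. *)
Lemma derivative_growth x (psi g : R -> R) (p q : R) :
  p <= q -> abs_continuous p q x ->
  {ae @mu R, forall t, p <= t -> t < q ->
     exists2 w, is_derive t (1 : R) x w & enorm w <= g t} ->
  (forall t, p <= t -> t <= q -> 0 <= g t) ->
  (forall t h, p <= t -> 0 <= h -> t + h <= q ->
     g t * h <= psi (t + h) - psi t) ->
  enorm (x q - x p) <= psi q - psi p.
Proof.
move=> pq ac aex g0 gpsi; apply: abs_continuous_growth => //.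
  move=> s t ps st tq; rewrite -subr_ge0.
  have : 0 <= g s * (t - s) by rewrite mulr_ge0 ?subr_ge0// g0//; lra.
  move=> /le_trans; apply.
  have := gpsi s (t - s) ps; rewrite subr_ge0 addrC subrK; exact.
apply: ae_imply aex => t H pt tq e e0; have [w dw wg] := H pt tq.
have [d d0 Hd] := is_derive_enorm dw e0; exists d => // h h0 hd thq.
have := Hd h; rewrite gtr0_norm// => /(_ hd) H1.
have := gpsi t h pt (ltW h0) thq.
have := ler_enormD (x (t + h) - x t - h *: w) (h *: w).
rewrite subrK enormZ gtr0_norm//.
have := ler_wpM2r (ltW h0) wg; lra.
Qed.

Lemma bounded_derivative_lipschitz x (M p q : R) : 0 <= M -> p <= q ->
  abs_continuous p q x ->
  {ae @mu R, forall t, p <= t -> t < q ->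
     exists2 w, is_derive t (1 : R) x w & enorm w <= M} ->
  enorm (x q - x p) <= M * (q - p).
Proof.
move=> M0 pq ac H; rewrite mulrBr.
apply: (derivative_growth (psi := fun t => M * t) (g := fun=> M)) => //.
by move=> t h _ _ _; lra.
Qed.

(* The factor [1 / 2] comes from the weight [expR (2 * L * t)]: it makes both the
   Picard operator a contraction and solutions unique. *)
Lemma exponential_gap_halving z (T L K : R) : 0 < L -> 0 <= K ->
  abs_continuous 0 T z -> z 0 = 0 ->
  {ae @mu R, forall t, 0 <= t -> t < T ->
     exists2 w, is_derive t (1 : R) z w & enorm w <= L * (K * expR (2 * L * t))} ->
  forall t, 0 <= t -> t <= T -> enorm (z t) <= K / 2 * expR (2 * L * t).
Proof.
move=> L0 K0 ac z0 aez t t0 tT.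
have := @derivative_growth z (fun t => K / 2 * expR (2 * L * t))
  (fun t => L * (K * expR (2 * L * t))) 0 t t0.
rewrite z0 subr0 mulr0 expR0 mulr1 => H; apply: le_trans (H _ _ _ _) _.
- exact: abs_continuousW ac.
- by apply: ae_imply aez => s Hs s0 st; apply: Hs => //; exact: lt_le_trans tT.
- by move=> s _ _; rewrite !mulr_ge0 ?expR_ge0// ltW.
- move=> s h _ h0 _; rewrite mulrDr expRD.
  have := expR_ge1Dx (2 * L * h); have := expR_ge0 (2 * L * s).
  set E := expR (2 * L * s); set E' := expR (2 * L * h) => E0 E1.
  have : 0 <= K * E * (E' - (1 + 2 * L * h)) by apply: mulr_ge0; [exact: mulr_ge0 | rewrite subr_ge0].
  lra.
- lra.
Qed.

End VectorDerivative.

(** [2 * C / 2 ^+ k] is the tail of the geometric series from [k] on, so the intervals of that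
    radius around [a k] are nested; the limit is the supremum of their left ends. *)
Lemma geometric_limit (R : realType) (a : nat -> R) (C : R) :
  (forall k, `|a k.+1 - a k| <= C / 2 ^+ k) ->
  exists l, forall k, `|a k - l| <= 2 * C / 2 ^+ k.
Proof.
move=> aC; pose lo k := a k - 2 * C / 2 ^+ k; pose hi k := a k + 2 * C / 2 ^+ k.
have CS k : 2 * C / 2 ^+ k.+1 = C / 2 ^+ k.
  by rewrite exprS invfM mulrACA divff ?mul1r ?pnatr_eq0.
have C2 k : 2 * C / 2 ^+ k = C / 2 ^+ k + C / 2 ^+ k by rewrite -mulrA mulr2n mulrDl mul1r.
have lo_nd : {homo lo : i j / (i <= j)%N >-> i <= j}.
  apply: homo_leq => // [|k]; first exact: le_trans.
  by rewrite /lo CS C2; have := aC k; rewrite ler_norml; lra.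
have hi_ni : {homo hi : i j / (i <= j)%N >-> j <= i}.
  apply: homo_leq => // [j i k ji kj|k]; first exact: le_trans kj ji.
  by rewrite /hi CS C2; have := aC k; rewrite ler_norml; lra.
have lohi i j : lo i <= hi j.
  apply: (@le_trans _ _ (lo (maxn i j))); first by apply: lo_nd; exact: leq_maxl.
  apply: (@le_trans _ _ (hi (maxn i j))); last by apply: hi_ni; exact: leq_maxr.
  have : 0 <= C / 2 ^+ maxn i j := le_trans (normr_ge0 _) (aC _).
  by rewrite /lo /hi C2; lra.
exists (sup (range lo)) => k; rewrite ler_norml.
have : lo k <= sup (range lo).
  by apply: ub_le_sup; [exists (hi 0%N) => _ [i _ <-] | exists k].
have : sup (range lo) <= hi k.
  by apply: ge_sup; [exists (lo 0%N), 0%N | move=> _ [i _ <-]].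
by rewrite /lo /hi; lra.
Qed.

Lemma geometric_limit_row (R : realType) (n : nat) (a : nat -> 'rV[R]_n) (C : R) :
  (forall k, enorm (a k.+1 - a k) <= C / 2 ^+ k) ->
  exists l, forall k, enorm (a k - l) <= n%:R * (2 * C) / 2 ^+ k.
Proof.
move=> aC.
have /choice[l lP] : forall i, exists l : R, forall k, `|a k ord0 i - l| <= 2 * C / 2 ^+ k.
  move=> i; apply: geometric_limit => k; apply: le_trans (aC k).
  by have := coord_le_enorm (a k.+1 - a k) i; rewrite !mxE.
exists (\row_i l i) => k; rewrite -mulrA; apply: enorm_le_coord => i.
by rewrite !mxE; exact: lP.
Qed.

Lemma le0_geometric (R : realType) (a C : R) :
  (forall k : nat, a <= C / 2 ^+ k) -> a <= 0.
Proof.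
move=> aC; rewrite leNgt; apply/negP => a0.
have C0 : 0 < C by have := aC 0%N; rewrite expr0 divr1; exact: lt_le_trans.
pose k := Num.truncn (C / a).
have : C / a < 2 ^+ k.+1.
  apply: lt_le_trans (truncnS_gt _) _.
  by rewrite -natrX ler_nat ltnW// ltn_expl.
rewrite ltr_pdivrMr// mulrC -ltr_pdivrMr ?exprn_gt0//.
by rewrite ltNge aC.
Qed.

(** * Picard iteration *)

(** Clamping at 0 separates the history part of a time from its future part; being contractions, the
    clamps carry continuity across the junction in glued paths and in driver shifts. *)
Lemma min_max_contraction (R : realType) (s t : R) :
  `|Num.min s 0 - Num.min t 0| <= `|s - t| /\
  `|Num.max s 0 - Num.max t 0| <= `|s - t|.
Proof.
have := ler_norm (s - t); have := ler_norm (t - s); rewrite (distrC t s).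
rewrite !ler_norml /Num.min /Num.max; move: `|_| => N.
by case: ltP => s0; case: ltP => t0 h1 h2; do 2! [split | apply/andP]; lra.
Qed.

Section Trajectories.
Variables (R : realType) (Delta : R) (n : nat).
Implicit Types (x y : R -> 'rV[R]_n) (s t : R).

Lemma segment_hist x (A : set R) (t : R) :
  {within A, continuous x} -> `[t - Delta, t] `<=` A -> hist Delta (segment x t).
Proof.
move=> /within_continuous_enormP xc tA; apply/within_continuous_enormP => s.
rewrite /= in_itv/= => /andP[s1 s2] e e0.
have inA r : - Delta <= r -> r <= 0 -> A (t + r).
  by move=> r1 r2; apply: tA; rewrite /= in_itv/=; apply/andP; split; lra.
have [d d0 H] := xc (t + s) (inA _ s1 s2) e e0; exists d => // r.
rewrite in_itv/= => /andP[r1 r2] rs; apply: H; first exact: inA.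
by rewrite opprD addrACA subrr add0r.
Qed.

Lemma continuous_glue x x0 (M : R) : 0 <= Delta -> hist Delta x0 ->
  (forall s, - Delta <= s <= 0 -> x s = x0 s) ->
  (forall s t, 0 <= s -> s <= t -> enorm (x t - x s) <= M * (t - s)) ->
  {within [set t | - Delta <= t], continuous x}.
Proof.
move=> D0 /within_continuous_enormP hx0 xx0 xM.
have xM' s t : 0 <= s -> 0 <= t -> enorm (x t - x s) <= `|M| * `|t - s|.
  move=> s0 t0; have [st|ts] := leP s t.
    apply: le_trans (xM s t s0 st) _.
    have -> : `|t - s| = t - s by rewrite ger0_norm// subr_ge0.
    by apply: ler_wpM2r; rewrite ?subr_ge0// ler_norm.
  rewrite enormBC distrC; apply: le_trans (xM t s t0 (ltW ts)) _.
  have -> : `|s - t| = s - t by rewrite ger0_norm// subr_ge0 ltW.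
  by apply: ler_wpM2r; rewrite ?subr_ge0 ?(ltW ts)// ler_norm.
apply/within_continuous_enormP => t /= tD e e0.
have mD s : - Delta <= s -> `[- Delta, 0]%classic (Num.min s 0).
  by move=> sD; rewrite /= in_itv/= le_min sD oppr_le0 D0 ge_min lexx orbT.
have [|d d0 H] := hx0 _ (mD t tD) (e / 2); first by rewrite divr_gt0.
have M1 : 0 < 2 * (`|M| + 1) by rewrite mulr_gt0// ltr_wpDl.
exists (Num.min d (e / (2 * (`|M| + 1)))); first by rewrite lt_min d0 divr_gt0.
move=> s sD; rewrite lt_min => /andP[sd]; rewrite ltr_pdivlMr// => se.
(* The first summand sees only the initial history and the second only the Lipschitz part, so no
   case analysis on the signs of [s] and [t] is needed. *)
have split_x r : x r = x (Num.min r 0) + (x (Num.max r 0) - x 0).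
  by case: (leP r 0) => _; rewrite ?subrr ?addr0// addrC subrK.
have [c1 c2] := min_max_contraction s t.
have H1 : enorm (x (Num.min s 0) - x (Num.min t 0)) < e / 2.
  have hs := mD s sD; have ht := mD t tD.
  rewrite !xx0; [|by move: ht; rewrite /= in_itv|by move: hs; rewrite /= in_itv].
  by apply: H => //; exact: le_lt_trans c1 sd.
have H2 : enorm (x (Num.max s 0) - x (Num.max t 0)) <= `|M| * `|s - t|.
  apply: le_trans (xM' _ _ _ _) _; rewrite ?le_max ?lexx ?orbT//.
  by rewrite ler_wpM2l.
have -> : x s - x t = (x (Num.min s 0) - x (Num.min t 0)) +
    (x (Num.max s 0) - x (Num.max t 0)).
  by rewrite (split_x s) (split_x t) opprD addrACA opprB (addrA _ (x 0)) subrK.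
apply: le_lt_trans (ler_enormD _ _) _.
by have := normr_ge0 (s - t); lra.
Qed.

End Trajectories.

Section Picard.
Variables (R : realType) (Delta : R) (n : nat) (x0 : R -> 'rV[R]_n).
Variables (F : (R -> 'rV[R]_n) -> R -> 'rV[R]_n) (L M : R).
Implicit Types (x y : R -> 'rV[R]_n) (s t K : R).

Local Notation lebesgueType :=
  (g_sigma_algebraType (completed_algebra_gen (@lebesgue_measure R))).
Local Notation cont x := ({within [set t : R | - Delta <= t], continuous x}).
Local Notation weight t := (expR (2 * L * t)).

Hypotheses (Delta0 : 0 <= Delta) (hist_x0 : hist Delta x0).
Hypotheses (L0 : 0 < L) (M0 : 0 <= M).
Hypothesis F_bounded : forall x t, cont x -> 0 <= t -> enorm (F x t) <= M.
Hypothesis F_lipschitz : forall x y t K, cont x -> cont y -> 0 <= t ->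
  (forall s, t - Delta <= s <= t -> enorm (x s - y s) <= K) ->
  enorm (F x t - F y t) <= L * K.
Hypothesis F_measurable : forall x i, cont x ->
  measurable_fun (`[0, +oo[ : set lebesgueType) (fun t => F x t ord0 i).

(** The Picard operator as a relation, since the antiderivative is obtained only existentially. The
    factor [n] in the Lipschitz constant comes from integrating coordinate by coordinate. *)
Definition picard_image (x y : R -> 'rV[R]_n) :=
  [/\ (forall s, - Delta <= s <= 0 -> y s = x0 s),
      (forall s t, 0 <= s -> s <= t -> enorm (y t - y s) <= n%:R * M * (t - s)) &
      {ae @mu R, forall t, 0 <= t -> is_derive t (1 : R) y (F x t)}].

Lemma picard_image_ex x : cont x -> exists y, picard_image x y.
Proof.
move=> xc; have /choice[G GP] : forall i, exists G : R -> R, [/\ G 0 = 0,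
    (forall s t : R, 0 <= s -> s <= t -> `|G t - G s| <= M * (t - s)) &
    {ae @mu R, forall t : R, 0 < t -> is_derive t (1 : R) G (F x t ord0 i)}].
  move=> i; have [h [mh hF aeh]] := borel_ae_version (F_measurable i xc).
  have hM t : `|h t| <= M.
    have [->|[t0 ->]] := hF t; first by rewrite normr0.
    exact: le_trans (coord_le_enorm _ _) (F_bounded xc t0).
  have [G [G0 GM aeG]] := bounded_antiderivative mh hM.
  exists G; split => //; apply: ae_imply2 aeh aeG => t ht Gt t0.
  by rewrite -ht ?ltW//; exact: Gt.
pose y t := if t <= 0 then x0 t else x0 0 + \row_i G i t.
have yE t : 0 <= t -> y t = x0 0 + \row_i G i t.
  move=> t0; rewrite /y; case: leP => // t0'.
  have -> : t = 0 by apply/eqP; rewrite eq_le t0 t0'.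
  have -> : \row_i G i 0 = 0 by apply/rowP => i; rewrite !mxE; have [] := GP i.
  by rewrite addr0.
exists y; split.
- by move=> s /andP[_ s0]; rewrite /y s0.
- move=> s t s0 st; rewrite !yE//; last exact: le_trans st.
  rewrite opprD addrACA subrr add0r -mulrA; apply: enorm_le_coord => i.
  by rewrite !mxE; have [_ H _] := GP i; exact: H.
- have aeG : {ae @mu R, forall t : R, forall i, 0 < t ->
      is_derive t (1 : R) (G i) (F x t ord0 i)}.
    by apply: ae_forall_ord => i; have [] := GP i.
  (* The derivative is two-sided and the history need not be differentiable at the junction 0, a
     single negligible time. *)
  apply: ae_imply2 (ae_neq 0) aeG => t tn0 Gt t0; have {tn0}t0 : 0 < t by rewrite lt_neqAle eq_sym tn0.
  apply: (@is_derive_local _ _ (fun s => x0 0 + \row_i G i s) _ _ t) => //.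
    move=> s; rewrite ltr_norml => /andP[st _]; rewrite yE//; lra.
  apply: is_derive_row => i; have dG := Gt i t0.
  have -> : (fun s => (x0 0 + \row_i G i s) ord0 i) = cst (x0 0 ord0 i) + G i.
    by apply/funext => s; rewrite !mxE.
  by rewrite -[F x t ord0 i]add0r; exact: is_deriveD.
Qed.

Lemma picard_image_cont x y : picard_image x y -> cont y.
Proof. by move=> [yx0 yM _]; exact: continuous_glue yx0 yM. Qed.

Lemma picard_contraction x x' y y' K : cont x -> cont x' -> 0 <= K ->
  (forall s, - Delta <= s <= 0 -> x s = x' s) ->
  (forall t, 0 <= t -> enorm (x t - x' t) <= K * weight t) ->
  picard_image x y -> picard_image x' y' ->
  forall t, 0 <= t -> enorm (y t - y' t) <= K / 2 * weight t.
Proof.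
move=> xc x'c K0 xx' xK [yx0 yM aey] [y'x0 y'M aey'] t t0.
have z0 : y 0 - y' 0 = 0 by rewrite yx0 ?y'x0 ?subrr// oppr_le0 Delta0 lexx.
apply: (@exponential_gap_halving _ _ (fun t => y t - y' t) t L K L0 K0 _ z0 _ t t0 (lexx t)).
  by apply: abs_continuousB; apply: lipschitz_abs_continuous => s r s0 sr _;
    [exact: yM | exact: y'M].
apply: ae_imply2 aey aey' => s ys y's s0 st; exists (F x s - F x' s).
  exact: is_deriveB (ys s0) (y's s0).
(* The delay is harmless: the paths agree on the history, and the weight is increasing, so its value
   at [t] dominates that at every earlier [r]. *)
apply: F_lipschitz => // r /andP[r1 r2].
have KE q : 0 <= K * weight q by rewrite mulr_ge0 ?expR_ge0.
have [r0|r0] := leP r 0.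
  by rewrite xx' ?subrr ?enorm0// r0 andbT; lra.
apply: le_trans (xK r (ltW r0)) _; rewrite ler_wpM2l// ler_expR.
by rewrite ler_wpM2l// mulr_ge0// ltW.
Qed.

(** The iterates converge pointwise at rate [2 ^- k] in the exponential weight, on the whole
    half-line at once. The limit inherits the Lipschitz bound, hence continuity, and one more
    contraction step identifies it with its own Picard image from [- Delta] on. *)
Theorem picard_fixpoint : exists y,
  [/\ (forall s, - Delta <= s <= 0 -> y s = x0 s),
      (forall s t, 0 <= s -> s <= t -> enorm (y t - y s) <= n%:R * M * (t - s)) &
      {ae @mu R, forall t, 0 <= t -> is_derive t (1 : R) y (F y t)}].
Proof.
have /choice[P PP] : forall x, exists y, cont x -> picard_image x y.
  move=> x; have [xc|nxc] := pselect (cont x); last by exists x.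
  by have [y Hy] := picard_image_ex xc; exists y.
pose y_ := fix y_ (k : nat) := if k is k'.+1 then P (y_ k')
  else fun t => x0 (Num.min t 0).
have y0x0 s : - Delta <= s <= 0 -> y_ 0%N s = x0 s.
  by move=> /andP[_ s0] /=; rewrite min_l.
have y0c : cont (y_ 0%N).
  apply: (continuous_glue (M := 0) Delta0 hist_x0 y0x0) => s t s0 st /=.
  by rewrite !min_r// ?subrr ?enorm0 ?mul0r//; exact: le_trans st.
have yc k : cont (y_ k).
  by elim: k => // k IH; apply: (@picard_image_cont (y_ k)); exact: PP.
have yP k : picard_image (y_ k) (y_ k.+1) by exact: PP.
have yx0 k s : - Delta <= s <= 0 -> y_ k s = x0 s.
  by case: k => [|k]; [exact: y0x0 | have [+ _ _] := yP k; exact].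
have z00 : - Delta <= 0 <= (0 : R) by apply/andP; split; rewrite ?oppr_le0.
(* The first gap is at most [n * M * t], and [2 * L * t <= expR (2 * L * t)] turns this into [C]
   times the weight. *)
pose C := n%:R * M / (2 * L).
have C0 : 0 <= C by rewrite divr_ge0 ?mulr_ge0// ltW// mulr_gt0.
have gap k t : 0 <= t -> enorm (y_ k.+1 t - y_ k t) <= C * weight t / 2 ^+ k.
  elim: k t => [|k IH] t t0.
    rewrite expr0 divr1 [y_ 0%N t]/= min_r// -(yx0 1%N 0 z00).
    have [_ yM _] := yP 0%N; apply: le_trans (yM 0 t (lexx _) t0) _.
    rewrite subr0 /C -!mulrA ler_wpM2l// ler_wpM2l//.
    rewrite -ler_pdivrMl ?invr_gt0 ?mulr_gt0// invrK.
    by rewrite (mulrA 2 L t); have := expR_ge1Dx (2 * L * t); lra.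
  have := @picard_contraction (y_ k.+1) (y_ k) (y_ k.+2) (y_ k.+1) (C / 2 ^+ k)
    (yc _) (yc _) _ _ _ (yP _) (yP _) t t0.
  rewrite divr_ge0 ?exprn_ge0// => /(_ isT); move=> H; apply: le_trans (H _ _) _.
  - by move=> s sD; rewrite !yx0.
  - by move=> s s0; rewrite mulrAC; exact: IH.
  - by rewrite exprS invfM le_eqVlt; apply/orP; left; apply/eqP; ring.
clearbody C.
have /choice[y yl] : forall t, exists l, (0 <= t -> forall k,
    enorm (y_ k t - l) <= n%:R * (2 * (C * weight t)) / 2 ^+ k) /\
    (- Delta <= t <= 0 -> l = x0 t).
  move=> t; have [t0|t0] := ltP 0 t.
    have [l lP] := geometric_limit_row (fun k => gap k t (ltW t0)).
    by exists l; split => // /andP[].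
  exists (x0 t); split => // t0' k.
  have -> : t = 0 by apply/eqP; rewrite eq_le t0 t0'.
  rewrite (yx0 _ _ z00) subrr enorm0; apply: divr_ge0; last exact: exprn_ge0.
  by rewrite !mulr_ge0 ?expR_ge0.
pose B := n%:R * (2 * C).
have B0 : 0 <= B by rewrite !mulr_ge0.
have ylim t k : 0 <= t -> enorm (y_ k t - y t) <= B / 2 ^+ k * weight t.
  by move=> t0; have [/(_ t0 k) + _] := yl t; rewrite /B; congr (_ <= _); ring.
have yx t : - Delta <= t <= 0 -> y t = x0 t by have [_] := yl t.
have yM s t : 0 <= s -> s <= t -> enorm (y t - y s) <= n%:R * M * (t - s).
  move=> s0 st; rewrite -subr_le0.
  apply: (@le0_geometric _ _ (B * weight t + B * weight s)) => k.
  have t0 := le_trans s0 st.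
  have [_ yMk _] := yP k; have Hk := yMk s t s0 st.
  have := ylim t k.+1 t0; have := ylim s k.+1 s0.
  have := ler_enorm_trans (y t) (y_ k.+1 t) (y s).
  have := ler_enorm_trans (y_ k.+1 t) (y_ k.+1 s) (y s).
  rewrite (enormBC (y t) (y_ k.+1 t)); set E1 := weight t; set E2 := weight s.
  have : B / 2 ^+ k.+1 * E1 <= B / 2 ^+ k * E1.
    rewrite ler_wpM2r ?expR_ge0// ler_wpM2l// lef_pV2 ?posrE ?exprn_gt0//.
    by rewrite ler_weXn2l// ler1n.
  have : B / 2 ^+ k.+1 * E2 <= B / 2 ^+ k * E2.
    rewrite ler_wpM2r ?expR_ge0// ler_wpM2l// lef_pV2 ?posrE ?exprn_gt0//.
    by rewrite ler_weXn2l// ler1n.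
  have -> : (B * E1 + B * E2) / 2 ^+ k = B / 2 ^+ k * E1 + B / 2 ^+ k * E2 by ring.
  lra.
have ycont : cont y by exact: continuous_glue yx yM.
have yfix : picard_image y (P y) by exact: PP.
have Pyx t : - Delta <= t <= 0 -> P y t = y t.
  by move=> tD; have [H _ _] := yfix; rewrite H// yx.
have Pyy t : 0 <= t -> P y t = y t.
  move=> t0; apply/eqP; rewrite -subr_eq0; apply/eqP/enorm0_eq0.
  apply: (@le0_geometric _ _ (2 * (B * weight t))) => k.
  have B2 j : 0 <= B / 2 ^+ j by rewrite divr_ge0// exprn_ge0.
  have := @picard_contraction (y_ k) y (y_ k.+1) (P y) _ (yc _) ycont (B2 k) _ _ (yP k) yfix t t0.
  move=> H; have {}H := H _ _.
  have := ler_enorm_trans (P y t) (y_ k.+1 t) (y t).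
  rewrite (enormBC (P y t) (y_ k.+1 t)).
  have := ylim t k.+1 t0; rewrite [_ ^+ k.+1]exprS invfM => H1 H2.
  apply: le_trans H2 _; apply: le_trans (lerD (H _ _) H1) _.
  - by move=> s sD; rewrite yx0// yx.
  - by move=> s s0; exact: ylim.
  - have -> : B / 2 ^+ k / 2 * weight t + B * (2^-1 / 2 ^+ k) * weight t =
      B * weight t / 2 ^+ k by field; rewrite expf_neq0// pnatr_eq0.
    rewrite ler_pM2r ?invr_gt0 ?exprn_gt0//.
    by have : 0 <= B * weight t by [rewrite mulr_ge0 ?expR_ge0]; lra.
have Pc := picard_image_cont yfix.
have [Px PM Pae] := yfix.
(* [P y] is returned instead of [y] because it carries the derivative. The two agree only from
   [- Delta] on, which suffices for [F (P y) t = F y t] by the Lipschitz bound with [K = 0]. *)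
exists (P y); split => //.
apply: ae_imply Pae => t H t0.
have -> : F (P y) t = F y t; last exact: H.
apply/eqP; rewrite -subr_eq0; apply/eqP/enorm0_eq0.
rewrite -(mulr0 L); apply: F_lipschitz => // s /andP[s1 s2].
have [s0|s0] := leP 0 s; first by rewrite Pyy// subrr enorm0.
by rewrite Pyx ?subrr ?enorm0// (ltW s0) andbT; lra.
Qed.

End Picard.

(** * Truncated solutions and uniqueness *)

(** Uniform continuity of [x] is what makes [segment x t] depend continuously on [t] in
    [hist_norm]. *)
Lemma heine_cantor (R : realType) (n : nat) (x : R -> 'rV[R]_n) (a b : R) :
  {within `[a, b], continuous x} -> forall e : R, 0 < e ->
  exists2 d : R, 0 < d & forall s t : R, a <= s <= b -> a <= t <= b ->
    `|s - t| < d -> enorm (x s - x t) < e.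
Proof.
move=> /within_continuous_enormP xc e e0.
pose P (d t : R) := a <= t <= b -> forall s, a <= s <= b -> `|s - t| < d ->
  enorm (x s - x t) < e.
have /compact_near_coveringP/(_ R (0 : R)^'+ P) : compact `[a, b] by exact: segment_compact.
case=> [t tab|d/= d0 H].
- have [|d d0 Hd] := xc t tab (e / 2); first by rewrite divr_gt0.
  exists (ball t (d / 2), [set s : R | 0 < s < d / 2]) => /=.
    split; first by apply: nbhsx_ballx; rewrite divr_gt0.
    by near=> s; apply/andP; split; near: s; [exact: nbhs_right_gt|apply: nbhs_right_lt; rewrite divr_gt0].
  move=> [t' d'] [/=]; rewrite /ball/= => tt' /andP[d'0 d'd] t'ab s sab st'.
  have t't : `|t' - t| < d by rewrite distrC; lra.
  have st : `|s - t| < d.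
    have -> : s - t = (s - t') + (t' - t) by lra.
    by apply: le_lt_trans (ler_normD _ _) _; rewrite (distrC t'); lra.
  have A r : a <= r <= b -> `[a, b]%classic r by rewrite /= in_itv.
  have := Hd s (A _ sab) st; have := Hd t' (A _ t'ab) t't.
  have := ler_enorm_trans (x s) (x t) (x t').
  by rewrite (enormBC (x t)); lra.
- exists (d / 2); first by rewrite divr_gt0.
  move=> s t sab tab st; apply: (H (d / 2)) => //=.
  + by rewrite sub0r normrN gtr0_norm ?divr_gt0//; lra.
  + by rewrite divr_gt0.
Unshelve. all: by end_near. Qed.

Lemma continuous_itv_bounded (R : realType) (n : nat) (x : R -> 'rV[R]_n) (a b : R) :
  {within `[a, b], continuous x} ->
  exists2 M, 0 <= M & forall t, a <= t <= b -> enorm (x t) <= M.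
Proof.
move=> xc; have [ab|ba] := leP a b.
  have [c _ H] := EVT_max ab (within_continuous_enorm xc).
  exists (enorm (x c)); first exact: enorm_ge0.
  by move=> t tab; apply: H; rewrite in_itv.
by exists 0 => // t; lra.
Qed.

Section Clip.
Variables (R : realType) (n : nat).
Implicit Types (r : R) (x y : 'rV[R]_n).

(** Projection onto a cube instead of a ball: nonexpansiveness in the Euclidean norm can then be
    checked coordinatewise. It fixes the ball of radius [r] and maps into the ball of radius
    [n * r]. *)
Definition clip r x : 'rV[R]_n :=
  \row_i Num.max (- r) (Num.min r (x ord0 i)).

Lemma enorm_clip r x : 0 <= r -> enorm (clip r x) <= n%:R * r.
Proof.
move=> r0; apply: enorm_le_coord => i; rewrite mxE ler_norml /Num.max /Num.min.
by case: (ltP r (x ord0 i)) => h1; case: ltP => h2; apply/andP; split; lra.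
Qed.

Lemma clip_id r x : enorm x <= r -> clip r x = x.
Proof.
move=> xr; apply/rowP => i; rewrite mxE.
have := le_trans (coord_le_enorm x i) xr; rewrite ler_norml => /andP[h1 h2].
by rewrite (min_r h2) max_r.
Qed.

Lemma clip_lipschitz r x y : enorm (clip r x - clip r y) <= enorm (x - y).
Proof.
rewrite /enorm ler_sqrt; last by rewrite sumr_ge0// => i _; exact: sqr_ge0.
apply: ler_sum => i _; rewrite !mxE -[leLHS]real_normK ?num_real//.
rewrite -[leRHS]real_normK ?num_real// ler_sqr ?nnegrE//.
set a := x _ _; set b := y _ _.
wlog ab : a b / a <= b => [H|].
  by have [/H//|/ltW/H] := leP a b; rewrite distrC (distrC b).
have -> : `|a - b| = b - a by rewrite distrC ger0_norm ?subr_ge0.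
rewrite ler_norml /Num.max /Num.min.
by case: (ltP r a) => h1; case: (ltP r b) => h2; case: ltP => h3; case: ltP => h4;
  apply/andP; split; lra.
Qed.

Lemma hist_clip (Delta : R) r (phi : R -> 'rV[R]_n) : hist Delta phi ->
  hist Delta (clip r \o phi).
Proof.
move=> /within_continuous_enormP hphi; apply/within_continuous_enormP => t tD e e0.
have [d d0 H] := hphi t tD e e0; exists d => // s sD st.
by apply: le_lt_trans (clip_lipschitz _ _ _) _; exact: H.
Qed.

End Clip.

Lemma histB (R : realType) (Delta : R) (n : nat) (phi psi : R -> 'rV[R]_n) :
  hist Delta phi -> hist Delta psi -> hist Delta (phi - psi).
Proof.
move=> /within_continuous_enormP h1 /within_continuous_enormP h2.
apply/within_continuous_enormP => t tD e e0.
have e2 : 0 < e / 2 by rewrite divr_gt0.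
have [d d0 H] := h1 t tD _ e2; have [d' d'0 H'] := h2 t tD _ e2.
exists (Num.min d d'); first by rewrite lt_min d0.
move=> s sD; rewrite lt_min => /andP[/(H s sD){}H /(H' s sD){}H'].
have -> : (phi - psi) s - (phi - psi) t = (phi s - phi t) - (psi s - psi t).
  by rewrite !fctE !opprD !opprK addrACA.
by apply: le_lt_trans (ler_enormB _ _) _; lra.
Qed.

Section System.
Variables (R : realType) (Delta : R) (n m : nat).
Variable f : (R -> 'rV[R]_n) -> 'rV[R]_m -> 'rV[R]_n.
Hypotheses (Delta0 : 0 <= Delta) (f_lip : vector_field_lipschitz Delta f).
Implicit Types (phi psi x y : R -> 'rV[R]_n) (u : R -> 'rV[R]_m) (s t rho r K : R).

Local Notation bounded_by rho phi :=
  (forall s, - Delta <= s <= 0 -> enorm (phi s) <= rho).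

(** Working form of the hypothesis, with pointwise bounds in place of [hist_norm]. The maximum with
    1 makes the constant positive, as it is divided by later. *)
Lemma vector_field_lipschitz_ball rho r : exists2 L, 0 < L &
  forall phi psi v w K, hist Delta phi -> hist Delta psi ->
    bounded_by rho phi -> bounded_by rho psi -> enorm v <= r -> enorm w <= r ->
    bounded_by K (phi - psi) ->
    enorm (f phi v - f psi w) <= L * (K + enorm (v - w)).
Proof.
pose B : set ((R -> 'rV[R]_n) * 'rV[R]_m) :=
  [set p | [/\ hist Delta p.1, bounded_by rho p.1 & enorm p.2 <= r]].
have B_hist : B `<=` hist Delta (n:=n) `*` setT by move=> p [hp _ _].
have [|L HL] := f_lip B_hist.
  by exists (rho + r) => p [hp p1 p2]; apply: lerD => //; exact: hist_norm_le.
exists (Num.max L 1); first by rewrite lt_max ltr01 orbT.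
move=> phi psi v w K hphi hpsi bphi bpsi vr wr bK.
have /= := HL (phi, v) (psi, w) (And3 hphi bphi vr) (And3 hpsi bpsi wr).
move=> /le_trans; apply.
have h0 := hist_norm_ge0 Delta0 (histB hphi hpsi).
have hK := hist_norm_le Delta0 bK.
apply: (@le_trans _ _ (Num.max L 1 * (hist_norm Delta (phi - psi) + enorm (v - w)))).
  by apply: ler_wpM2r; rewrite ?le_max ?lexx// addr_ge0// enorm_ge0.
by apply: ler_wpM2l; rewrite ?lerD2r// le_max ler01 orbT.
Qed.

Lemma vector_field_eq phi psi v : hist Delta phi -> hist Delta psi ->
  (forall s, - Delta <= s <= 0 -> phi s = psi s) -> f phi v = f psi v.
Proof.
move=> hphi hpsi eq_phi.
have [s _ [_ smax]] := hist_norm_attained Delta0 hphi.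
have [L _ H] := vector_field_lipschitz_ball (enorm (phi s)) (enorm v).
apply/eqP; rewrite -subr_eq0; apply/eqP/enorm0_eq0.
apply: (@le_trans _ _ (L * (0 + enorm (v - v)))); last by rewrite subrr enorm0 addr0 mulr0.
apply: H => //; first by move=> t tD; rewrite -eq_phi//; exact: smax.
by move=> t tD; rewrite !fctE eq_phi// subrr enorm0.
Qed.

Lemma vector_field_bounded rho r : f 0 0 = 0 -> 0 <= rho -> 0 <= r ->
  exists2 M, 0 <= M & forall phi v, hist Delta phi -> bounded_by rho phi ->
    enorm v <= r -> enorm (f phi v) <= M.
Proof.
move=> f00 rho0 r0; have [L L0 H] := vector_field_lipschitz_ball rho r.
exists (L * (rho + r)); first by rewrite mulr_ge0 ?addr_ge0// ltW.
move=> phi v hphi bphi vr; have := H phi 0 v 0 rho hphi (@hist0 _ _ _) bphi.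
rewrite f00 !subr0 enorm0 => /(_ _ vr r0 bphi) H1.
apply: le_trans (H1 _) _ => [s _|]; first by rewrite enorm0.
by rewrite ler_wpM2l ?lerD2l// ltW.
Qed.

Local Notation lebesgueType :=
  (g_sigma_algebraType (completed_algebra_gen (@lebesgue_measure R))).

Lemma continuous_signal_measurable u (g : 'rV[R]_m -> R) :
  lebesgue_measurable_signal u ->
  (forall v (e : R), 0 < e -> exists2 d : R, 0 < d &
     forall w, enorm (v - w) < d -> `|g v - g w| < e) ->
  measurable_fun (`[0, +oo[%classic : set lebesgueType) (fun t : lebesgueType => g (u t)).
Proof.
move=> mu_u gc; apply: (measurability _ (RGenOpens.measurableE R)).
move=> _ [_ [a [b ->]] <-]; apply: (mu_u (g @^-1` `]a, b[)).
rewrite openE => v; rewrite /= in_itv/= => /andP[av vb].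
have [|d d0 H] := gc v (Num.min (g v - a) (b - g v)).
  by rewrite lt_min !subr_gt0 av.
have m0 : 0 < m%:R + 1 :> R by rewrite ltr_wpDl.
apply/nbhs_ballP; exists (d / (m%:R + 1)); first by rewrite /= divr_gt0.
move=> w; rewrite -ball_normE/= => vw.
have /H : enorm (v - w) < d.
  apply: le_lt_trans (enorm_le_norm _) _.
  by move: vw; rewrite ltr_pdivlMr//; have := normr_ge0 (v - w); lra.
rewrite lt_min !ltr_norml in_itv/= => /andP[/andP[? ?] /andP[? ?]].
by apply/andP; split; lra.
Qed.

(** Both arguments are clipped: [u] exceeds [r] at most on a null set, but the Picard hypotheses ask
    for bounds at every time. *)
Lemma truncated_solution_ex rho r (x0 : R -> 'rV[R]_n) u : 0 <= rho -> 0 <= r -> f 0 0 = 0 ->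
  hist Delta x0 -> lebesgue_measurable_signal u ->
  exists y (M : R), [/\ (forall s, - Delta <= s <= 0 -> y s = x0 s),
    (forall s t, 0 <= s -> s <= t -> enorm (y t - y s) <= M * (t - s)) &
    {ae @mu R, forall t, 0 <= t ->
      is_derive t (1 : R) y (f (clip rho \o segment y t) (clip r (u t)))}].
Proof.
move=> rho0 r0 f00 hx0 mes_u.
have [|| M M0 fM] := @vector_field_bounded (n%:R * rho) (m%:R * r) f00; try by rewrite mulr_ge0.
have [L L0 fL] := vector_field_lipschitz_ball (n%:R * rho) (m%:R * r).
have seg x t : {within [set t : R | - Delta <= t], continuous x} -> 0 <= t ->
    hist Delta (segment x t).
  by move=> xc t0; apply: segment_hist xc _ => s /=; rewrite in_itv/= => /andP[? _]; lra.
have bc phi : bounded_by (n%:R * rho) (clip rho \o phi).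
  by move=> s _; exact: enorm_clip.
pose F x t := f (clip rho \o segment x t) (clip r (u t)).
have FB x t : {within [set t : R | - Delta <= t], continuous x} -> 0 <= t ->
    enorm (F x t) <= M.
  move=> xc t0; apply: fM (bc _) (enorm_clip _ r0); apply: hist_clip; exact: seg.
have FL x y t K : {within [set t : R | - Delta <= t], continuous x} ->
    {within [set t : R | - Delta <= t], continuous y} -> 0 <= t ->
    (forall s, t - Delta <= s <= t -> enorm (x s - y s) <= K) ->
    enorm (F x t - F y t) <= L * K.
  move=> xc yc t0 xyK; have := fL _ _ (clip r (u t)) (clip r (u t)) K
    (hist_clip (seg x t xc t0)) (hist_clip (seg y t yc t0))
    (bc _) (bc _) (enorm_clip _ r0) (enorm_clip _ r0).
  rewrite subrr enorm0 addr0; apply.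
  move=> s sD; apply: le_trans (clip_lipschitz _ _ _) _; apply: xyK.
  by move: sD => /andP[? ?]; apply/andP; split; lra.
have Fm x (i : 'I_n) : {within [set t : R | - Delta <= t], continuous x} ->
    measurable_fun (`[0, +oo[%classic : set lebesgueType) (fun t : lebesgueType => F x t ord0 i).
  move=> xc.
  (* With the history frozen at [tau], the field is a continuous function of [u t], hence
     measurable; its dependence on [tau] is continuous by uniform continuity of [x] on
     [[- Delta, t]]. *)
  apply: (measurable_diagonal (Phi := fun tau (t : lebesgueType) =>
    f (clip rho \o segment x tau) (clip r (u t)) ord0 i)) => [tau tau0|t t0 e e0].
    apply: (continuous_signal_measurable (g := fun v =>
      f (clip rho \o segment x tau) (clip r v) ord0 i) mes_u) => v.
    have h := @hist_clip _ _ _ rho _ (seg x tau xc tau0).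
    move=> e e0; exists (e / L); first by rewrite divr_gt0.
    move=> w; rewrite ltr_pdivlMr// mulrC; apply: le_lt_trans.
    have H := fL _ _ (clip r v) (clip r w) 0 h h (bc _) (bc _)
      (enorm_clip _ r0) (enorm_clip _ r0).
    rewrite add0r in H.
    have := coord_le_enorm (f (clip rho \o segment x tau) (clip r v) -
      f (clip rho \o segment x tau) (clip r w)) i.
    rewrite !mxE => /le_trans; apply; apply: le_trans (H _) _.
      by move=> s _; rewrite subrr enorm0.
    by rewrite ler_wpM2l ?(ltW L0)//; exact: clip_lipschitz.
  have xc' : {within `[- Delta, t], continuous x}.
    by apply: continuous_subspaceW xc => s /=; rewrite in_itv/= => /andP[].
  have [|d d0 Hd] := heine_cantor xc' (_ : 0 < e / (2 * L)).
    by rewrite divr_gt0// mulr_gt0.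
  exists d => // tau tau0 taut td.
  have := coord_le_enorm (f (clip rho \o segment x tau) (clip r (u t)) -
        f (clip rho \o segment x t) (clip r (u t))) i.
  rewrite !mxE => /le_lt_trans; apply.
  have h1 := @hist_clip _ _ _ rho _ (seg x tau xc tau0).
  have h2 := @hist_clip _ _ _ rho _ (seg x t xc t0).
  have H := fL _ _ (clip r (u t)) (clip r (u t)) (e / (2 * L)) h1 h2 (bc _) (bc _)
        (enorm_clip _ r0) (enorm_clip _ r0).
  rewrite subrr enorm0 addr0 in H.
  have LE : L * (e / (2 * L)) = e / 2 by field; rewrite gt_eqF.
  rewrite LE in H; apply: le_lt_trans (H _) _; last lra.
  move=> s /andP[s1 s2]; apply: le_trans (clip_lipschitz _ _ _) _; apply/ltW/Hd.
  - by apply/andP; split; lra.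
  - by apply/andP; split; lra.
  - by rewrite opprD addrACA subrr addr0 distrC ger0_norm// subr_ge0.
have [y [yx0 yM yae]] := @picard_fixpoint R Delta n x0 F L M Delta0 hx0 L0 M0 FB FL Fm.
by exists y, (n%:R * M).
Qed.

Lemma delayed_time_itv s t (T : R) : 0 <= t -> t <= T -> - Delta <= s -> s <= 0 ->
  - Delta <= t + s <= T.
Proof. by move=> t0 tT s1 s2; apply/andP; split; lra. Qed.

Lemma is_solution_itv (x0 : R -> 'rV[R]_n) u b x t :
  is_solution Delta f x0 u b x -> (t%:E < b)%E ->
  {within `[- Delta, t], continuous x}.
Proof.
move=> [_ xc _ _ _] tb; apply: continuous_subspaceW xc => s /=.
by rewrite in_itv/= => /andP[? st]; split => //; apply: le_lt_trans tb; rewrite lee_fin.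
Qed.

Lemma solution_segment_hist (x0 : R -> 'rV[R]_n) u b x t :
  is_solution Delta f x0 u b x -> 0 <= t -> (t%:E < b)%E -> hist Delta (segment x t).
Proof.
move=> sol t0 tb; apply: segment_hist (is_solution_itv sol tb) _ => s /=.
by rewrite !in_itv/= => /andP[? ?]; apply/andP; split; lra.
Qed.

(** On [[- Delta, T]] both solutions are bounded, so one Lipschitz constant serves both. Their
    distance in the exponential weight is then bounded by half of any bound on it, starting from
    [Mx + My], and so vanishes. *)
Lemma is_solution_unique (x0 : R -> 'rV[R]_n) u b b' x y r :
  {ae @mu R, forall t, 0 <= t -> enorm (u t) <= r} ->
  is_solution Delta f x0 u b x -> is_solution Delta f x0 u b' y ->
  forall t, - Delta <= t -> (t%:E < b)%E -> (t%:E < b')%E -> x t = y t.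
Proof.
move=> ur solx soly T TD Tb Tb'.
have [b0 _ xx0 xac xae] := solx; have [b'0 _ yx0 yac yae] := soly.
have [T0|T0] := leP T 0; first by rewrite xx0 ?yx0 ?TD.
have [Mx Mx0 xM] := continuous_itv_bounded (is_solution_itv solx Tb).
have [My My0 yM] := continuous_itv_bounded (is_solution_itv soly Tb').
pose rho := Num.max Mx My.
have [L L0 fL] := vector_field_lipschitz_ball rho r.
have lt_b s : s <= T -> (s%:E < b)%E by move=> sT; apply: le_lt_trans Tb; rewrite lee_fin.
have lt_b' s : s <= T -> (s%:E < b')%E by move=> sT; apply: le_lt_trans Tb'; rewrite lee_fin.
have xy0 s : - Delta <= s <= 0 -> x s - y s = 0 by move=> sD; rewrite xx0// yx0// subrr.
have K0 (k : nat) : 0 <= (Mx + My) / 2 ^+ k by rewrite divr_ge0 ?addr_ge0// exprn_ge0.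
suff H (k : nat) t : 0 <= t -> t <= T ->
    enorm (x t - y t) <= (Mx + My) / 2 ^+ k * expR (2 * L * t).
  apply/eqP; rewrite -subr_eq0; apply/eqP/enorm0_eq0.
  apply: (@le0_geometric _ _ ((Mx + My) * expR (2 * L * T))) => k.
  by rewrite mulrAC; apply: H => //; exact: ltW.
elim: k t => [|k IH] t t0 tT.
  rewrite expr0 divr1; apply: (@le_trans _ _ (Mx + My)).
    apply: le_trans (ler_enormB _ _) _; apply: lerD; [apply: xM|apply: yM];
    by rewrite -[t]addr0; apply: delayed_time_itv; rewrite ?oppr_le0.
  rewrite ler_peMr ?addr_ge0// -expR0 ler_expR !mulr_ge0//; exact: ltW.
have := @exponential_gap_halving _ _ (fun t => x t - y t) T L ((Mx + My) / 2 ^+ k) L0 (K0 k).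
move=> H; have {H} H := H _ _ _ t t0 tT; apply: le_trans (H _ _ _) _.
- by apply: abs_continuousB; [apply: xac|apply: yac]; rewrite ?(ltW T0).
- by apply: xy0; rewrite lexx oppr_le0 Delta0.
- have {}ur : {ae @mu R, forall s, (0 <= s -> (s%:E < b)%E ->
      is_derive s (1 : R) x (f (segment x s) (u s))) /\ (0 <= s -> enorm (u s) <= r)}.
    by apply: ae_imply2 xae ur => s; split.
  apply: ae_imply2 ur yae => s [xs us] ys s0 sT.
  exists (f (segment x s) (u s) - f (segment y s) (u s)).
    by apply: is_deriveB; [apply: xs|apply: ys] => //; [apply: lt_b|apply: lt_b']; exact: ltW.
  have -> : (Mx + My) / 2 ^+ k * expR (2 * L * s) =
      (Mx + My) / 2 ^+ k * expR (2 * L * s) + enorm (u s - u s) by rewrite subrr enorm0 addr0.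
  have hx : hist Delta (segment x s) by apply: solution_segment_hist solx s0 _; apply: lt_b; exact: ltW.
  have hy : hist Delta (segment y s) by apply: solution_segment_hist soly s0 _; apply: lt_b'; exact: ltW.
  apply: fL => //; [| |exact: us|exact: us|].
  + move=> q /andP[q1 q2]; apply: le_trans (xM _ _) _; last by rewrite le_max lexx.
    by apply: delayed_time_itv => //; exact: ltW.
  + move=> q /andP[q1 q2]; apply: le_trans (yM _ _) _; last by rewrite le_max lexx orbT.
    by apply: delayed_time_itv => //; exact: ltW.
  + move=> q /andP[q1 q2]; rewrite !fctE /segment.
    have /andP[sq1 sq2] := delayed_time_itv s0 (ltW sT) q1 q2.
    have [sq|sq] := leP (s + q) 0.
      rewrite xy0 ?enorm0; last exact/andP.
      by apply: mulr_ge0; rewrite ?expR_ge0.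
    apply: le_trans (IH _ (ltW sq) sq2) _.
    by rewrite ler_wpM2l// ler_expR ler_wpM2l ?mulr_ge0 ?(ltW L0)// gerDl.
- by rewrite exprS invfM le_eqVlt; apply/orP; left; apply/eqP; ring.
Qed.

End System.

(** * Comparison along driver shifts *)

Lemma limf_esup_right_lt (R : realType) (q : R -> R) (B e : R) : 0 < e ->
  (limf_esup (fun h => (q h)%:E) 0^'+ <= B%:E)%E ->
  exists2 d : R, 0 < d & forall h, 0 < h -> h < d -> q h < B + e.
Proof.
move=> e0 qB.
have /ereal_inf_lt[_ [A /= A0 <-] Ae] :
    (limf_esup (fun h => (q h)%:E) 0^'+ < (B + e)%:E)%E.
  by apply: le_lt_trans qB _; rewrite lte_fin ltrDl.
have /nbhs_ballP[d/= d0 dA] : nbhs (0 : R) (fun h => 0 < h -> A h) by [].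
exists d => // h h0 hd; rewrite -lte_fin; apply: le_lt_trans Ae.
apply: ereal_sup_ubound; exists h => //; apply: dA => //.
by rewrite /ball/= sub0r normrN gtr0_norm.
Qed.

(* The rate [M] only matters on the exceptional null set, where it is multiplied
   by an arbitrarily small total length. *)
Lemma ae_right_gronwall (R : realType) (v : R -> R) (T a C K M : R) :
  0 <= T -> 0 <= a -> 0 <= K -> C <= K -> v 0 < K ->
  {within `[0, T], continuous v} ->
  (forall t, 0 <= t -> t < T -> exists2 d : R, 0 < d &
     forall h, 0 < h -> h < d -> t + h <= T -> v (t + h) - v t <= M * h) ->
  {ae @mu R, forall t, 0 <= t -> t < T -> forall W, K <= W ->
     (forall s, 0 <= s <= t -> v s <= W) ->
     forall e : R, 0 < e -> exists2 d : R, 0 < d &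
       forall h, 0 < h -> h < d -> t + h <= T ->
         v (t + h) - v t <= (a * W + C + e) * h} ->
  v T <= K * expR ((a + 1) * T).
Proof.
move=> T0 a0 K0 CK v0K vc vM aev.
(* The extra 1 in the rate absorbs the constant term, since [C <= K <= w t]. *)
pose w t := K * expR ((a + 1) * t).
have a10 : 0 <= a + 1 by rewrite addr_ge0.
have w_nd s t : s <= t -> w s <= w t.
  by move=> st; rewrite ler_wpM2l// ler_expR ler_wpM2l.
have w_K t : 0 <= t -> K <= w t.
  move=> t0; have := w_nd 0 t t0; rewrite {1}/w mulr0 expR0 mulr1; exact.
have w_inc t h : 0 <= h -> (a + 1) * w t * h <= w (t + h) - w t.
  move=> h0; rewrite /w mulrDr expRD.
  have := expR_ge1Dx ((a + 1) * h); have := expR_ge0 ((a + 1) * t).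
  set E := expR ((a + 1) * t); set E' := expR ((a + 1) * h) => E0 E1.
  have : 0 <= K * E * (E' - (1 + (a + 1) * h)).
    by apply: mulr_ge0; [exact: mulr_ge0 | rewrite subr_ge0].
  lra.
have key tau : 0 <= tau -> tau <= T ->
    (forall s, 0 <= s -> s < tau -> v s <= w s) -> v tau - v 0 <= w tau - w 0.
  move=> tau0 tauT vw; apply/ler_addgt0Pr => e e0.
  (* [e1] is both the slack in the almost everywhere rate, costing [e1 * tau], and the total
     increase of the gauge, costing [|M| * e1]. *)
  have [e1 e10 eE] : exists2 e1, 0 < e1 & e1 * tau + `|M| * e1 <= e.
    have k0 : 0 < tau + `|M| + 1 by rewrite ltr_wpDl// addr_ge0.
    exists (e / (tau + `|M| + 1)); first by rewrite divr_gt0.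
    rewrite (mulrC `|M|) -mulrDr mulrAC ler_pdivrMr// ler_wpM2l ?(ltW e0)//.
    by rewrite lerDl.
  have [phi [phi_nd phi_e phiN]] := negligible_gauge aev e10.
  have vc' : {within `[0, tau], continuous v}.
    apply: continuous_subspaceW vc => s; rewrite /= !in_itv/= => /andP[-> /le_trans]; exact.
  have := @right_increment_le _ v (fun t => w t + e1 * t + `|M| * phi t) 0 tau tau0 vc'.
  have := phi_e 0; have := phi_e tau => /andP[_ p1] /andP[p2 _] H.
  have {}H := H _ _; apply: le_trans (H _ _) _.
  - move=> s t s0 st tt; apply: lerD; last by rewrite ler_wpM2l// phi_nd.
    by apply: lerD; [exact: w_nd | rewrite ler_wpM2l ?(ltW e10)].
  - move=> t t0 tt; have tT : t < T := lt_le_trans tt tauT.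
    pose Q t := forall W, K <= W -> (forall s, 0 <= s <= t -> v s <= W) ->
     forall e : R, 0 < e -> exists2 d : R, 0 < d &
       forall h, 0 < h -> h < d -> t + h <= T ->
         v (t + h) - v t <= (a * W + C + e) * h.
    have phi_inc h : 0 < h -> 0 <= `|M| * (phi (t + h) - phi t).
      by move=> h0; rewrite mulr_ge0// subr_ge0 phi_nd// lerDl ltW.
    have [Qt|NQt] := pselect (Q t).
      (* As [w] is nondecreasing and dominates [v] before [tau], the value [w t] is an admissible
         bound for the whole past of [t]. *)
      have [|d d0 Hd] := Qt (w t) (w_K t t0) _ e1 e10.
        move=> s /andP[s0 st]; apply: le_trans (w_nd _ _ st).
        by apply: vw => //; exact: le_lt_trans tt.
      exists d => // h h0 hd th; have := Hd h h0 hd (le_trans th tauT).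
      have : C * h <= w t * h.
        by rewrite ler_wpM2r ?(ltW h0)// (le_trans CK)// w_K.
      by have := w_inc t h (ltW h0); have := phi_inc h h0; lra.
    have [|d d0 Hd] := phiN t; first by move=> /= /(_ t0 tT).
    have [d' d'0 Hd'] := vM t t0 tT.
    exists (Num.min d d'); first by rewrite lt_min d0.
    move=> h h0; rewrite lt_min => /andP[hd hd'] th.
    have := Hd' h h0 hd' (le_trans th tauT).
    have : `|M| * h <= `|M| * (phi (t + h) - phi t) by rewrite ler_wpM2l// Hd.
    have : M * h <= `|M| * h by rewrite ler_wpM2r ?(ltW h0)// ler_norm.
    have := w_nd t (t + h); rewrite lerDl => /(_ (ltW h0)).
    have : 0 < e1 * h by rewrite mulr_gt0.
    lra.
  - have : `|M| * (phi tau - phi 0) <= `|M| * e1 by rewrite ler_wpM2l//; lra.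
    lra.
(* The strict inequality [v 0 < K] propagates: at the last time [sup S] there is still a gap below
   [w], which continuity carries beyond [sup S] unless it equals [T]. *)
have strict tau : 0 <= tau -> tau <= T ->
    (forall s, 0 <= s -> s < tau -> v s <= w s) -> v tau < w tau.
  move=> tau0 tauT vw; have := key tau tau0 tauT vw.
  by rewrite {2}/w mulr0 expR0 mulr1; lra.
pose S := [set t | 0 <= t <= T /\ forall s, 0 <= s -> s <= t -> v s <= w s].
have S0 : S 0.
  split; first by rewrite lexx T0.
  move=> s s0 s0'; have -> : s = 0 by apply/eqP; rewrite eq_le s0 s0'.
  by rewrite /w mulr0 expR0 mulr1 ltW.
have Sub : ubound S T by move=> t [/andP[]].
have hS : has_sup S by split; [exists 0 | exists T].
have tau0 : 0 <= sup S by apply: ub_le_sup => //; exists T.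
have tauT : sup S <= T by apply: ge_sup => //; exists 0.
have below s : 0 <= s -> s < sup S -> v s <= w s.
  move=> s0; rewrite -subr_gt0 => sS.
  have [t [_ H] ] := sup_adherent sS hS.
  by rewrite opprB addrC subrK => st; apply: H => //; exact: ltW.
have vtau := strict _ tau0 tauT below.
have [tauE|tauE] := eqVneq (sup S) T; first by move: vtau; rewrite tauE => /ltW.
have {tauE}tT : sup S < T by rewrite lt_neqAle tauE.
have [||d d0 Hd] := (within_continuousP _ _).1 vc (sup S) _ (w (sup S) - v (sup S)).
- by rewrite /= in_itv/= tau0.
- by rewrite subr_gt0.
exfalso; pose h := Num.min (d / 2) (T - sup S).
have h0 : 0 < h by rewrite lt_min divr_gt0//= subr_gt0.
have hd : h <= d / 2 by rewrite ge_min lexx.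
have hT : h <= T - sup S by rewrite ge_min lexx orbT.
have : S (sup S + h).
  split; first by apply/andP; split; lra.
  move=> s s0 sh; have [sS|sS] := ltP s (sup S); first exact: below.
  have := Hd s; rewrite /= in_itv/= s0 ger0_norm ?subr_ge0// => H.
  have {}H : `|v s - v (sup S)| < w (sup S) - v (sup S).
    by apply: H; lra.
  by have := w_nd _ _ sS; move: H; rewrite ltr_norml => /andP[_]; lra.
by move=> /(ub_le_sup (ex_intro _ T Sub)); lra.
Qed.

Section DriverShift.
Variables (R : realType) (Delta : R) (n : nat).
Implicit Types (phi : R -> 'rV[R]_n) (w : 'rV[R]_n) (h s : R).

(** A formula without cases, from which continuity across the junction [s = - h] is visible. *)
Lemma driver_shiftE phi h w s :
  driver_shift phi h w s = phi (Num.min (s + h) 0) + Num.max (h + s) 0 *: w.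
Proof.
rewrite /driver_shift (addrC h) /Num.min /Num.max.
have -> : (s < - h) = (s + h < 0) by rewrite -[RHS](ltrD2r (- h)) addrK add0r.
case: ifP => [H|/negbT]; first by rewrite scale0r addr0.
by rewrite -leNgt.
Qed.

Lemma driver_shift_hist phi h w : 0 <= Delta -> 0 <= h -> hist Delta phi ->
  hist Delta (driver_shift phi h w).
Proof.
move=> D0 h0 /within_continuous_enormP hphi; apply/within_continuous_enormP.
have mD s : s \in `[- Delta, 0] -> `[- Delta, 0]%classic (Num.min (s + h) 0).
  rewrite !in_itv/= => /andP[s1 s2]; rewrite in_itv/= le_min oppr_le0 D0 ge_min lexx orbT !andbT.
  by lra.
move=> t tD e e0; have [|d d0 H] := hphi _ (mD t tD) (e / 2); first by rewrite divr_gt0.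
have w1 : 0 < 2 * (enorm w + 1) by rewrite mulr_gt0// ltr_wpDl// enorm_ge0.
exists (Num.min d (e / (2 * (enorm w + 1)))); first by rewrite lt_min d0 divr_gt0.
move=> s sD; rewrite lt_min => /andP[sd]; rewrite ltr_pdivlMr// => se.
rewrite !driver_shiftE opprD addrACA -scalerBl.
have [c1 _] := min_max_contraction (s + h) (t + h).
have [_ c2] := min_max_contraction (h + s) (h + t).
have shE : s + h - (t + h) = s - t by rewrite opprD addrACA subrr addr0.
have hsE : h + s - (h + t) = s - t by rewrite opprD addrACA subrr add0r.
rewrite shE in c1; rewrite hsE in c2.
apply: le_lt_trans (ler_enormD _ _) _; rewrite enormZ.
have := H _ (mD s sD) (le_lt_trans c1 sd).
have := ler_wpM2r (enorm_ge0 w) c2; have := normr_ge0 (s - t); lra.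
Qed.

End DriverShift.

Section APriori.
Variables (R : realType) (Delta : R) (n m : nat).
Variables (f : (R -> 'rV[R]_n) -> 'rV[R]_m -> 'rV[R]_n) (V : (R -> 'rV[R]_n) -> R).
Hypotheses (Delta0 : 0 <= Delta) (f_lip : vector_field_lipschitz Delta f).
Hypothesis V_lip : functional_lipschitz Delta V.
Implicit Types (phi psi x y : R -> 'rV[R]_n) (u : R -> 'rV[R]_m) (s t rho r K : R).

Local Notation bounded_by rho phi :=
  (forall s, - Delta <= s <= 0 -> enorm (phi s) <= rho).

Lemma functional_lipschitz_ball rho : exists2 L, 0 < L &
  forall phi psi K, hist Delta phi -> hist Delta psi ->
    bounded_by rho phi -> bounded_by rho psi -> bounded_by K (phi - psi) ->
    `|V phi - V psi| <= L * K.
Proof.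
pose B : set (R -> 'rV[R]_n) := [set p | hist Delta p /\ bounded_by rho p].
have B_hist : B `<=` hist Delta (n:=n) by move=> p [].
have [|L HL] := V_lip B_hist; first by exists rho => p [_ ?]; exact: hist_norm_le.
exists (Num.max L 1); first by rewrite lt_max ltr01 orbT.
move=> phi psi K hphi hpsi bphi bpsi bK.
apply: le_trans (HL _ _ (conj hphi bphi) (conj hpsi bpsi)) _.
apply: (@le_trans _ _ (Num.max L 1 * hist_norm Delta (phi - psi))).
  by apply: ler_wpM2r; rewrite ?le_max ?lexx//; apply: hist_norm_ge0 => //; exact: histB.
by apply: ler_wpM2l; [rewrite le_max ler01 orbT | exact: hist_norm_le].
Qed.

(** The true segment at [t + h] and the driver shift in direction [w] coincide on [[- Delta, - h)]
    and differ by at most [k * h] on the rest, so replacing one by the other costs [L * k] in the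
    growth rate. A small [k] is possible when [w] is the derivative of [x] at [t]; for an arbitrary
    [w] a crude [k] comes from Lipschitz continuity of [x]. *)
Lemma segment_functional_growth x t w (B X L k e b : R) : 0 < e -> t < b -> 0 <= k ->
  (forall s, t <= s -> s < b -> hist Delta (segment x s)) ->
  (forall s, t - Delta <= s -> s < b -> enorm (x s) <= X) ->
  (forall phi psi K, hist Delta phi -> hist Delta psi ->
     bounded_by (X + enorm w) phi -> bounded_by (X + enorm w) psi ->
     bounded_by K (phi - psi) -> `|V phi - V psi| <= L * K) ->
  (driver_derivative V (segment x t) w <= B%:E)%E ->
  (exists2 d, 0 < d & forall h, 0 <= h -> h < d -> t + h < b ->
     enorm (x (t + h) - x t - h *: w) <= k * h) ->
  exists2 d, 0 < d & forall h, 0 < h -> h < d -> t + h < b ->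
    V (segment x (t + h)) - V (segment x t) <= (L * k + B + e) * h.
Proof.
move=> e0 tb k0 hx xX LV dB [d1 d10 Hd1].
have [d2 d20 Hd2] := limf_esup_right_lt e0 dB.
(* Keeping [h < 1] bounds the driver shift by [X + enorm w], the radius on which [L] is valid. *)
exists (Num.min 1 (Num.min d1 d2)); first by rewrite !lt_min ltr01 d10.
move=> h h0; rewrite !lt_min => /and3P[h1 hd1 hd2] thb.
have := Hd2 h h0 hd2; rewrite ltr_pdivrMr//.
set phi := driver_shift _ h w => Hd.
have hphi : hist Delta phi by apply: driver_shift_hist => //; [exact: ltW | apply: hx].
have hth : hist Delta (segment x (t + h)) by apply: hx => //; rewrite lerDl ltW.
suff HV : `|V (segment x (t + h)) - V phi| <= L * (k * h).
  by have := le_trans (ler_norm _) HV; lra.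
have w0 := enorm_ge0 w.
apply: LV => //.
- move=> s /andP[s1 s2]; apply: (@le_trans _ _ X); last by rewrite lerDl.
  by apply: xX; lra.
- move=> s /andP[s1 s2]; rewrite /phi driver_shiftE.
  apply: le_trans (ler_enormD _ _) _; apply: lerD.
    apply: xX; last by rewrite (le_lt_trans _ tb)// gerDl ge_min lexx orbT.
    by rewrite lerD2l le_min oppr_le0 Delta0 andbT; lra.
  rewrite enormZ -[leRHS]mul1r ler_wpM2r// ger0_norm ?le_max ?lexx ?orbT//.
  by rewrite ge_max ler01 andbT; lra.
- move=> s /andP[s1 s2]; rewrite !fctE /phi /driver_shift /segment.
  case: ifPn => [sh|].
    by rewrite -addrA (addrC h) subrr enorm0 mulr_ge0// ltW.
  rewrite -leNgt => sh.
  have -> : x (t + h + s) - (x (t + 0) + (h + s) *: w) =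
    x (t + (h + s)) - x t - (h + s) *: w by rewrite addr0 opprD !addrA.
  apply: (@le_trans _ _ (k * (h + s))); first by apply: Hd1; lra.
  by rewrite ler_wpM2l//; lra.
Qed.

End APriori.

(** * A priori bound *)

Lemma class_Kinfty_le (R : realType) (g : R -> R) (s t : R) :
  class_Kinfty g -> 0 <= s -> s <= t -> g s <= g t.
Proof.
move=> [_ g_inc _ _] s0; rewrite le_eqVlt => /predU1P[->//|st].
by apply/ltW/g_inc.
Qed.

Lemma class_Kinfty_ge0 (R : realType) (g : R -> R) (t : R) :
  class_Kinfty g -> 0 <= t -> 0 <= g t.
Proof. by move=> gK t0; have [_ _ <- _] := gK; exact: class_Kinfty_le. Qed.

Lemma class_Kinfty_unbounded (R : realType) (g : R -> R) (A : R) :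
  class_Kinfty g -> exists2 t, 0 < t & A <= g t.
Proof.
move=> [_ _ _ /cvgryPge/(_ A)[M [_ HM]]]; exists (Num.max M 0 + 1).
  by rewrite ltr_wpDl// le_max lexx orbT.
by apply: HM; rewrite ltr_pwDr// le_max lexx.
Qed.

Section APrioriBound.
Variables (R : realType) (Delta : R) (n m : nat).
Variables (f : (R -> 'rV[R]_n) -> 'rV[R]_m -> 'rV[R]_n) (V : (R -> 'rV[R]_n) -> R).
Variables (a c cbar : R) (alpha alphabar gamma : R -> R).
Hypotheses (Delta0 : 0 <= Delta) (f_lip : vector_field_lipschitz Delta f).
Hypotheses (f00 : f 0 0 = 0) (V_lip : functional_lipschitz Delta V).
Hypotheses (a0 : 0 <= a) (c0 : 0 <= c) (cbar0 : 0 <= cbar).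
Hypotheses (alphaK : class_Kinfty alpha) (alphabarK : class_Kinfty alphabar).
Hypothesis gammaN : class_N gamma.
Hypothesis V_bounds : forall phi, hist Delta phi ->
  alpha (enorm (phi 0)) <= V phi /\
  V phi <= alphabar (hist_norm Delta phi) + cbar.
Hypothesis V_driver : forall (phi : R -> 'rV[R]_n) (v : 'rV[R]_m), hist Delta phi ->
  (driver_derivative V phi (f phi v) <=
    (a * alpha (hist_norm Delta phi) + gamma (enorm v) + c)%:E)%E.
Implicit Types (x : R -> 'rV[R]_n) (u : R -> 'rV[R]_m) (s t r : R).

Lemma functional_along_continuous x t : {within `[- Delta, t], continuous x} ->
  {within `[0, t], continuous (fun s => V (segment x s))}.
Proof.
move=> xc; have [M M0 xM] := continuous_itv_bounded xc.
have [L L0 VL] := functional_lipschitz_ball Delta0 V_lip M.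
apply/within_continuousP => s sI e e0.
have [|d d0 Hd] := heine_cantor xc (_ : 0 < e / (2 * L)).
  by rewrite divr_gt0// mulr_gt0.
have seg q : `[0, t]%classic q -> hist Delta (segment x q).
  rewrite /= in_itv/= => /andP[q0 qt]; apply: segment_hist xc _ => p /=.
  by rewrite !in_itv/= => /andP[? ?]; apply/andP; split; lra.
have shift q p : `[0, t]%classic q -> - Delta <= p <= 0 -> - Delta <= q + p <= t.
  by rewrite /= in_itv/= => /andP[? ?] /andP[? ?]; apply/andP; split; lra.
exists d => // q qI qs; apply: (@le_lt_trans _ _ (L * (e / (2 * L)))).
  apply: VL; [exact: seg|exact: seg| | |] => p pI.
  - by apply: xM; exact: shift.
  - by apply: xM; exact: shift.
  - apply/ltW/Hd; [exact: shift|exact: shift|].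
    by rewrite opprD addrACA subrr addr0.
have -> : L * (e / (2 * L)) = e / 2 by field; rewrite gt_eqF.
lra.
Qed.

Lemma solution_lipschitz (x0 : R -> 'rV[R]_n) u b x (M X r T : R) :
  is_solution Delta f x0 u b x -> (T%:E < b)%E ->
  {ae @mu R, forall t, 0 <= t -> enorm (u t) <= r} ->
  (forall t, - Delta <= t <= T -> enorm (x t) <= X) ->
  0 <= M -> (forall (phi : R -> 'rV[R]_n) v, hist Delta phi ->
    (forall s, - Delta <= s <= 0 -> enorm (phi s) <= X) ->
    enorm v <= r -> enorm (f phi v) <= M) ->
  forall s t, 0 <= s -> s <= t -> t <= T -> enorm (x t - x s) <= M * (t - s).
Proof.
move=> sol Tb ur xX M0 fM s t s0 st tT.
have lt_b q : q <= T -> (q%:E < b)%E.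
  by move=> qT; apply: le_lt_trans Tb; rewrite lee_fin.
have [_ _ _ xac xae] := sol.
apply: bounded_derivative_lipschitz => //.
  by apply: xac => //; exact: lt_b.
apply: ae_imply2 ur xae => q uq xq sq qt.
have q0 := le_trans s0 sq; have qT := le_trans (ltW qt) tT.
exists (f (segment x q) (u q)); first by apply: xq => //; exact: lt_b.
apply: fM; [|move=> p /andP[p1 p2]|exact: uq].
  by apply: solution_segment_hist sol q0 _; exact: lt_b.
by apply: xX; exact: delayed_time_itv.
Qed.

(** The order of choices is the point: [K] and [rho] are fixed from [r] and [T] before any solution
    is given. The bounds [X], [Mf] and [L] depend on the solution and on [t1], but reach the
    comparison only through its rate [M], which is absent from the conclusion of
    [ae_right_gronwall]. *)
Lemma solution_enorm_bound (r T : R) : 0 < r -> 0 < T ->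
  exists2 rho : R, 0 < rho &
    forall (x0 : R -> 'rV[R]_n) u b x, hist Delta x0 -> hist_norm Delta x0 <= r ->
      {ae @mu R, forall t, 0 <= t -> enorm (u t) <= r} ->
      is_solution Delta f x0 u b x ->
      forall t, 0 <= t -> t <= T -> (t%:E < b)%E -> enorm (x t) <= rho.
Proof.
move=> r0 T0.
have [_ gamma_nd gamma0] := gammaN.
have gr0 : 0 <= gamma r by rewrite -gamma0; apply: gamma_nd => //; exact: ltW.
have [cge0 cbarge0] := (c0, cbar0).
(* [alpha r] covers delayed values in the initial history, [alphabar r + cbar] bounds [v 0],
   [gamma r + c] is the constant term of the rate, and the final 1 makes [v 0 < K] strict. *)
pose K := alpha r + alphabar r + cbar + gamma r + c + 1.
have ar0 := class_Kinfty_ge0 alphaK (ltW r0).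
have abr0 := class_Kinfty_ge0 alphabarK (ltW r0).
have K0 : 0 <= K by rewrite /K !addr_ge0.
have [rho rho0 rhoK] := class_Kinfty_unbounded (K * expR ((a + 1) * T) + 1) alphaK.
exists rho => // x0 u b x hx0 x0r ur sol t1 t10 t1T t1b.
have [_ _ xx0 xac xae] := sol.
have xc := is_solution_itv sol t1b.
have lt_b s : s <= t1 -> (s%:E < b)%E.
  by move=> st; apply: le_lt_trans t1b; rewrite lee_fin.
have seg s : 0 <= s -> s <= t1 -> hist Delta (segment x s).
  by move=> s0 st; apply: solution_segment_hist sol s0 _; exact: lt_b.
have segD s p : 0 <= s -> s <= t1 -> - Delta <= p <= 0 -> - Delta <= s + p <= t1.
  by move=> s0 st /andP[p1 p2]; exact: delayed_time_itv.
have [X X0 xX] := continuous_itv_bounded xc.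
have [Mf Mf0 fM] := vector_field_bounded Delta0 f_lip f00 X0 (ltW r0).
have xL := solution_lipschitz sol t1b ur xX Mf0 fM.
have [L L0 VL] := functional_lipschitz_ball Delta0 V_lip (X + Mf).
have hns s : 0 <= s -> s <= t1 -> hist_norm Delta (segment x s) <= X.
  by move=> s0 st; apply: hist_norm_le => // p pD; apply: xX; exact: segD.
have growth t w (B k e : R) : 0 <= t -> t < t1 -> enorm w <= Mf -> 0 < e -> 0 <= k ->
    (driver_derivative V (segment x t) w <= B%:E)%E ->
    (exists2 d : R, 0 < d & forall h, 0 <= h -> h < d -> t + h < t1 ->
       enorm (x (t + h) - x t - h *: w) <= k * h) ->
    exists2 d : R, 0 < d & forall h, 0 < h -> h < d -> t + h <= t1 ->
      V (segment x (t + h)) - V (segment x t) <= (L * k + B + e) * h.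
  move=> t0 tt1 wM e0 k0 dB dx.
  have [||phi psi K' h1 h2 b1 b2 bK|d d0 Hd] :=
      @segment_functional_growth _ Delta _ V Delta0 x t w B X L k e t1 e0 tt1 k0 _ _ _ dB dx.
  - by move=> s ts st; apply: seg; [exact: le_trans ts | exact: ltW].
  - by move=> s ts st; apply: xX; apply/andP; split; lra.
  - apply: VL => // s sD; [apply: le_trans (b1 s sD) _|apply: le_trans (b2 s sD) _];
    by rewrite lerD2l.
  exists (Num.min d (t1 - t)); first by rewrite lt_min d0 subr_gt0.
  by move=> h h0; rewrite lt_min => /andP[hd ht] _; apply: Hd => //; lra.
pose v s := V (segment x s).
suff vK : v t1 <= K * expR ((a + 1) * t1).
  have [Vlow _] := V_bounds (seg t1 t10 (lexx _)).
  rewrite leNgt; apply/negP => rhox.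
  have := class_Kinfty_le alphaK (ltW rho0) (ltW rhox).
  have : K * expR ((a + 1) * t1) <= K * expR ((a + 1) * T).
    by rewrite ler_wpM2l// ler_expR ler_wpM2l// addr_ge0.
  by move: Vlow; rewrite /segment addr0 -/(segment x t1) -/(v t1); lra.
(* In the everywhere rate, [2 * Mf] adds the speed of [x] and that of the driver direction, both at
   most [Mf]. *)
apply: (@ae_right_gronwall _ v t1 a (gamma r + c) K
  (L * (2 * Mf) + (a * alpha X + gamma (enorm (0 : 'rV[R]_m)) + c) + 1)) => //.
- by rewrite /K; lra.
- have [_ Vup] := V_bounds (seg 0 (lexx _) t10).
  apply: le_lt_trans Vup _; rewrite /K.
  suff : alphabar (hist_norm Delta (segment x 0)) <= alphabar r by lra.
  apply: (class_Kinfty_le alphabarK); first exact/(hist_norm_ge0 Delta0)/seg.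
  apply: le_trans x0r; apply: hist_norm_le => // s sD.
  by rewrite /segment add0r xx0//; exact: enorm_le_hist_norm.
- exact: functional_along_continuous.
- move=> t t0 tt1; have hs := seg t t0 (ltW tt1).
  have w_le : enorm (f (segment x t) 0) <= Mf.
    by apply: fM => //; [move=> s sD; apply: xX; exact: segD (ltW tt1) sD | rewrite enorm0 ltW].
  apply: (growth t (f (segment x t) 0)) => //; first by rewrite mulr_ge0.
    apply: le_trans (V_driver 0 hs) _; rewrite lee_fin !lerD2r ler_wpM2l//.
    apply: (class_Kinfty_le alphaK); first exact: (hist_norm_ge0 Delta0 hs).
    exact: hns (ltW tt1).
  exists 1 => // h h0 _ th; apply: le_trans (ler_enormB _ _) _.
  have := xL t (t + h) t0; rewrite lerDl => /(_ h0 (ltW th)).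
  rewrite enormZ ger0_norm//; have := ler_wpM2l h0 w_le; lra.
- apply: ae_imply2 ur xae => t ut xt t0 tt1 W KW vW e e0.
  have hs := seg t t0 (ltW tt1).
  have utr := ut t0; have dx := xt t0 (lt_b t (ltW tt1)).
  have w_le : enorm (f (segment x t) (u t)) <= Mf.
    by apply: fM => // s sD; apply: xX; exact: segD (ltW tt1) sD.
  have e2 : 0 < e / 2 by rewrite divr_gt0.
  have k0 : 0 < e / 2 / L by rewrite divr_gt0.
  (* Here [w] is the derivative of [x], so [k] can be [e / 2 / L]: the replacement error [L * k] and
     the slack of the upper limit take half of [e] each. *)
  have [||d d0 Hd] := @growth t (f (segment x t) (u t)) (a * W + (gamma r + c))
    (e / 2 / L) (e / 2) t0 tt1 w_le e2 (ltW k0) _ _.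
  + apply: le_trans (V_driver (u t) hs) _; rewrite lee_fin -addrA.
    apply: lerD; last by rewrite lerD2r; apply: gamma_nd => //; exact: enorm_ge0.
    rewrite ler_wpM2l//; have [s sD [-> _]] := hist_norm_attained Delta0 hs.
    have /andP[ts1 ts2] := segD t s t0 (ltW tt1) sD.
    have [ts|ts] := leP (t + s) 0.
      apply: le_trans KW; apply: (@le_trans _ _ (alpha r)); last by rewrite /K; lra.
      apply: (class_Kinfty_le alphaK); first exact: enorm_ge0.
      rewrite /segment xx0; last exact/andP.
      by apply: le_trans x0r; apply: enorm_le_hist_norm => //; exact/andP.
    have [Vlow _] := V_bounds (seg (t + s) (ltW ts) ts2).
    have -> : segment x t s = segment x (t + s) 0 by rewrite /segment addr0.
    apply: le_trans Vlow _; apply: vW; rewrite (ltW ts)/=.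
    by case/andP: sD => _ s0; rewrite gerDl.
  + have [d d0 Hd] := is_derive_enorm dx k0; exists d => // h h0 hd _.
    by have := Hd h; rewrite ger0_norm// => /(_ hd).
  exists d => // h h0 hd th; apply: le_trans (Hd h h0 hd th) _.
  rewrite ler_wpM2r ?(ltW h0)//.
  have -> : L * (e / 2 / L) = e / 2 by field; rewrite gt_eqF.
  lra.
Qed.

End APrioriBound.

(** * Global solutions *)

Section GlobalSolution.
Variables (R : realType) (Delta : R) (n m : nat).
Variable f : (R -> 'rV[R]_n) -> 'rV[R]_m -> 'rV[R]_n.
Variables (x0 : R -> 'rV[R]_n) (u : R -> 'rV[R]_m) (r : R).
Hypotheses (Delta0 : 0 <= Delta) (f_lip : vector_field_lipschitz Delta f).
Hypotheses (f00 : f 0 0 = 0) (r0 : 0 <= r) (hist_x0 : hist Delta x0).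
Hypothesis x0_le : hist_norm Delta x0 <= r.
Hypothesis u_measurable : lebesgue_measurable_signal u.
Hypothesis u_le : {ae @mu R, forall t, 0 <= t -> enorm (u t) <= r}.
Implicit Types (x y : R -> 'rV[R]_n) (s t rho : R).

(** Both clips are inactive: the one on [u] for almost every time, the one on the segment because
    future values are bounded by assumption and history values by [r <= rho]. *)
Lemma truncated_is_solution y rho (M T : R) : 0 < T -> r <= rho ->
  (forall s, - Delta <= s <= 0 -> y s = x0 s) ->
  (forall s t, 0 <= s -> s <= t -> enorm (y t - y s) <= M * (t - s)) ->
  {ae @mu R, forall t, 0 <= t ->
    is_derive t (1 : R) y (f (clip rho \o segment y t) (clip r (u t)))} ->
  (forall t, 0 <= t -> t < T -> enorm (y t) <= rho) ->
  is_solution Delta f x0 u T%:E y.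
Proof.
move=> T0 rrho yx0 yM yae yrho; split => //.
- apply: continuous_subspaceW (continuous_glue Delta0 hist_x0 yx0 yM).
  by move=> t [].
- move=> s t s0 st tT; apply: (lipschitz_abs_continuous (M := M)) => p q sp pq _.
  by apply: yM => //; exact: le_trans sp.
- apply: ae_imply2 u_le yae => t ut yt t0; rewrite lte_fin => tT.
  have := yt t0; rewrite (clip_id (ut t0)).
  suff -> : f (clip rho \o segment y t) (u t) = f (segment y t) (u t) by [].
  have hy : hist Delta (segment y t).
    apply: segment_hist (continuous_glue Delta0 hist_x0 yx0 yM) _ => s /=.
    by rewrite in_itv/= => /andP[? _]; lra.
  apply: (vector_field_eq Delta0 f_lip) => //; first exact: hist_clip.
  move=> s sD; apply: clip_id; rewrite /segment.
  have [s0|s0] := leP 0 (t + s).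
    by apply: yrho => //; case/andP: sD => _ ?; lra.
  have tsD : - Delta <= t + s <= 0.
    by case/andP: sD => ? _; rewrite (ltW s0) andbT; lra.
  rewrite yx0//; apply: le_trans rrho; apply: le_trans x0_le.
  exact: enorm_le_hist_norm.
Qed.

(** The truncation radius exceeds the a priori bound by a margin of 1. A truncated solution needs at
    least time [2 * eta] to use up this margin, so the a priori bound at an earlier time keeps it in
    the larger ball. *)
Lemma bounded_horizon_solution rho (T : R) : 0 < T ->
  (forall b x, is_solution Delta f x0 u b x -> forall t, 0 <= t -> t <= T ->
     (t%:E < b)%E -> enorm (x t) <= rho) ->
  exists y, is_solution Delta f x0 u T%:E y.
Proof.
move=> T0 rhoP; pose rho' := Num.max rho r + 1.
have rrho' : r + 1 <= rho' by rewrite lerD2r le_max lexx orbT.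
have rhorho' : rho + 1 <= rho' by rewrite lerD2r le_max lexx.
have rho'0 : 0 <= rho' by move: r0 rrho'; lra.
have [y [M [yx0 yM yae]]] := truncated_solution_ex Delta0 f_lip rho'0 r0 f00 hist_x0 u_measurable.
exists y; pose eta := (2 * (`|M| + 1))^-1.
have M1 : 0 < `|M| + 1 by rewrite ltr_wpDl.
have eta0 : 0 < eta by rewrite invr_gt0 mulr_gt0.
have etaM s t : 0 <= s -> s <= t -> t - s <= 2 * eta -> enorm (y t) <= enorm (y s) + 1.
  move=> s0 st ts; have := ler_enormD (y t - y s) (y s); rewrite subrK.
  have := yM s t s0 st.
  have : M * (t - s) <= `|M| * (t - s) by rewrite ler_wpM2r ?subr_ge0// ler_norm.
  have : `|M| * (t - s) <= `|M| * (2 * eta) by rewrite ler_wpM2l.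
  have : (`|M| + 1) * (2 * eta) = 1 by rewrite /eta; field; rewrite gt_eqF.
  move: eta0; lra.
have y0r : enorm (y 0) <= r.
  have D0 : - Delta <= 0 <= (0 : R) by rewrite lexx oppr_le0 Delta0.
  by rewrite yx0//; apply: le_trans x0_le; exact: enorm_le_hist_norm.
have step (j : nat) t : 0 <= t -> t <= T -> t <= j%:R * eta -> enorm (y t) <= rho'.
  elim: j t => [|j IH] t t0 tT.
    rewrite mul0r => t0'; have -> : t = 0 by apply/eqP; rewrite eq_le t0' t0.
    by apply: le_trans y0r _; lra.
  rewrite -natr1 mulrDl mul1r => tj.
  (* Stepping back by [2 * eta], not [eta], puts the earlier time strictly before [j * eta], inside
     the half-open interval on which [y] is already known to solve the original system. *)
  have [ts|ts] := leP t (2 * eta).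
    by have := etaM 0 t (lexx _) t0; rewrite subr0 => /(_ ts); lra.
  have s0 : 0 <= t - 2 * eta by rewrite subr_ge0 ltW.
  have sj : t - 2 * eta < j%:R * eta by lra.
  pose tau := Num.min T (j%:R * eta).
  have stau : t - 2 * eta < tau by rewrite lt_min sj andbT; lra.
  have sol : is_solution Delta f x0 u tau%:E y.
    apply: (@truncated_is_solution y rho' M) => //; first exact: le_lt_trans stau.
      by apply: le_trans rrho'; rewrite lerDl.
    by move=> s s0'; rewrite lt_min => /andP[sT sj']; apply: IH => //; exact: ltW.
  have := rhoP _ _ sol _ s0; rewrite lte_fin => /(_ _ stau) H.
  have st : t - 2 * eta <= t by move: eta0; lra.
  have st' : t - (t - 2 * eta) <= 2 * eta by lra.
  apply: le_trans (etaM _ _ s0 st st') _; apply: le_trans rhorho'.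
  by rewrite lerD2r; apply: H; exact: le_trans tT.
apply: (@truncated_is_solution y rho' M) => //.
  by apply: le_trans rrho'; rewrite lerDl.
move=> t t0 tT; apply: (step (Num.truncn (T / eta)).+1) => //; first exact: ltW.
by rewrite -ler_pdivrMr//; apply/ltW/(lt_trans _ (truncnS_gt _)); rewrite ltr_pM2r ?invr_gt0.
Qed.

(** By uniqueness the solutions on growing horizons agree where they overlap, so any of them defines
    the glued path; [y k] lives up to [k + 1], and index 0 covers the history because [Num.truncn]
    is 0 on negative reals. *)
Lemma glued_solution :
  (forall T : R, 0 < T -> exists y, is_solution Delta f x0 u T%:E y) ->
  exists x, is_solution Delta f x0 u +oo%E x.
Proof.
move=> ex_sol.
have /choice[y yP] : forall k : nat, exists y, is_solution Delta f x0 u (k.+1%:R)%:E y.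
  by move=> k; exact: ex_sol.
pose x t := y (Num.truncn t) t.
have xy k t : - Delta <= t -> t < k.+1%:R -> x t = y k t.
  move=> tD tk; apply: (is_solution_unique Delta0 f_lip u_le (yP _) (yP k)) => //.
    by rewrite lte_fin truncnS_gt.
(* One index above [Num.truncn t], a single solution covers every later time within distance 1 of
   [t], as continuity and derivatives at [t] require. *)
have near_k t s : `|s - t| < 1 -> s < (Num.truncn t).+2%:R.
  rewrite ltr_norml => /andP[_ st]; have := truncnS_gt t.
  by rewrite -[X in _ -> _ < X]natr1; lra.
have t_k t : t < (Num.truncn t).+2%:R by apply: near_k; rewrite subrr normr0.
exists x; split; first by rewrite ltry.
- apply/within_continuous_enormP => t [tD _] e e0.
  have [_ /within_continuous_enormP yc _ _ _] := yP (Num.truncn t).+1.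
  have [||d d0 Hd] := yc t _ e; [by split; rewrite ?lte_fin|by []|].
  exists (Num.min d 1); first by rewrite lt_min d0 ltr01.
  move=> s [sD _]; rewrite lt_min => /andP[sd s1].
  rewrite (xy (Num.truncn t).+1 s)//; last exact: near_k.
  rewrite (xy (Num.truncn t).+1 t)//.
  by apply: Hd => //; split; rewrite ?lte_fin//; exact: near_k.
- move=> s sD; have [_ _ H _ _] := yP 0%N; rewrite -H//; apply: xy.
    by case/andP: sD.
  by case/andP: sD => _ s0; apply: le_lt_trans s0 _; rewrite ltr01.
- move=> s t s0 st _; have [_ _ _ H _] := yP (Num.truncn t).+1.
  apply: (@eq_abs_continuous _ _ (y (Num.truncn t).+1)); last first.
    by apply: H => //; rewrite lte_fin.
  move=> q sq qt; rewrite (xy (Num.truncn t).+1)//; last exact: le_lt_trans (t_k t).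
  by move: Delta0; lra.
- have : {ae @mu R, forall t, forall k : nat, 0 <= t -> (t%:E < (k.+1%:R)%:E)%E ->
      is_derive t (1 : R) (y k) (f (segment (y k) t) (u t))}.
    by apply: ae_forall_nat => k; have [] := yP k.
  (* When [Delta = 0], the two-sided derivative at 0 would see values left of [- Delta], where [x]
     and [y k] may differ; this single time is discarded. *)
  apply: ae_imply2 (ae_neq 0) => t tn0 yt t0 _.
  have {tn0}t0' : 0 < t by rewrite lt_neqAle eq_sym tn0.
  pose k := (Num.truncn t).+1.
  have D0 : - Delta <= 0 by rewrite oppr_le0.
  have seg_x : hist Delta (segment (y k) t).
    by apply: (solution_segment_hist (yP k)) => //; rewrite lte_fin.
  have eq_seg s : - Delta <= s <= 0 -> segment x t s = segment (y k) t s.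
    move=> /andP[s1 s2]; apply: xy; first by lra.
    by apply: le_lt_trans (t_k t); rewrite gerDl.
  have hx : hist Delta (segment x t).
    apply/within_continuous_enormP => s sI e e0.
    have [d d0 Hd] := (within_continuous_enormP _ _).1 seg_x s sI e e0.
    exists d => // q qI qs; rewrite !eq_seg; first exact: Hd.
    + by move: sI; rewrite /= in_itv.
    + by move: qI; rewrite /= in_itv.
  rewrite (vector_field_eq Delta0 f_lip (u t) hx seg_x eq_seg).
  apply: (@is_derive_local _ _ (y k) _ _ (Num.min t 1)); first by rewrite lt_min t0' ltr01.
    move=> s; rewrite lt_min => /andP[st s1]; apply/esym/xy; last exact: near_k.
    by move: st; rewrite ltr_norml => /andP[? _]; lra.
  by apply: yt => //; rewrite lte_fin.
Qed.

End GlobalSolution.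

Lemma signal_norm_ae (R : realType) (m : nat) (u : R -> 'rV[R]_m) (r : R) :
  (signal_norm u <= r%:E)%E -> {ae @mu R, forall t, 0 <= t -> enorm (u t) <= r}.
Proof.
move=> /ess_supP; apply: ae_imply => t + t0.
by rewrite patchE ifT ?lee_fin// inE /= in_itv/= t0.
Qed.

Theorem lemma2 (R : realType) (Delta : R) (n m : nat)
    (f : (R -> 'rV[R]_n) -> 'rV[R]_m -> 'rV[R]_n)
    (V : (R -> 'rV[R]_n) -> R) (a c cbar : R) (alpha alphabar gamma : R -> R) :
  0 <= Delta -> (1 <= n)%N -> (1 <= m)%N ->
  vector_field_lipschitz Delta f -> f 0 0 = 0 ->
  (forall phi, hist Delta phi -> 0 <= V phi) -> functional_lipschitz Delta V ->
  0 <= a -> 0 <= c -> 0 <= cbar ->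
  class_Kinfty alpha -> class_Kinfty alphabar -> class_N gamma ->
  (forall phi, hist Delta phi ->
     alpha (enorm (phi 0)) <= V phi /\
     V phi <= alphabar (hist_norm Delta phi) + cbar) ->
  (forall (phi : R -> 'rV[R]_n) (v : 'rV[R]_m), hist Delta phi ->
     (driver_derivative V phi (f phi v) <=
        (a * alpha (hist_norm Delta phi) + gamma (enorm v) + c)%:E)%E) ->
  robustly_forward_complete Delta f.
Proof.
move=> D0 _ _ f_lip f00 _ V_lip a0 c0 cbar0 alphaK alphabarK gammaN V_bounds V_driver.
have bound := solution_enorm_bound D0 f_lip f00 V_lip a0 c0 cbar0 alphaK alphabarK
  gammaN V_bounds V_driver.
move=> T r T0 r0; have [rho rho0 rhoP] := bound r T r0 T0; exists rho => //.
move=> x0 u hx0 [u_meas _] x0r /signal_norm_ae ur.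
have ex_sol N : 0 < N -> exists y, is_solution Delta f x0 u N%:E y.
  move=> N0; have [rho' _ rho'P] := bound r N r0 N0.
  apply: (bounded_horizon_solution (rho := rho') D0 f_lip f00 (ltW r0) hx0 x0r u_meas ur N0).
  by move=> b x sol; exact: rho'P hx0 x0r ur sol.
split.
  have [x solx] := glued_solution D0 f_lip ur ex_sol.
  by exists +oo%E, x; split => // b' x' _ _; exact: leey.
move=> b x [sol maxx].
have Tb : (T%:E < b)%E.
  (* A maximal solution agrees by uniqueness with a solution on the longer horizon [T + 1], so
     maximality gives [T + 1 <= b]. *)
  have [y soly] := ex_sol (T + 1) (addr_gt0 T0 ltr01).
  apply: (@lt_le_trans _ _ (T + 1)%:E); first by rewrite lte_fin ltrDl.
  apply: (maxx _ y) => // t tD tb tT.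
  exact: (is_solution_unique D0 f_lip ur soly sol).
split => //; apply: ge_ereal_sup => _ [t + <-]; rewrite /= in_itv/= => /andP[t0 tT].
rewrite lee_fin; apply: (rhoP _ _ _ _ hx0 x0r ur sol) => //.
by apply: le_lt_trans Tb; rewrite lee_fin.
Qed.
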